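(* Consider a finite POMDP with geometrically distributed horizon as in the context. Define the belief-state cost function $$L(\pi_k,u_k)\triangleq E_{X_k}[\ell(X_k,u_k)\mid\pi_k,u_k]=\sum_{x\in\mathcal X}\pi_k(x)\ell(x,u_k),$$ where $\ell(x_k,u_k)\triangleq(1-\gamma)c_T(x_k)+\gamma c(x_k,u_k)+\gamma\beta\tilde c(x_k,u_k)$ and $$\tilde c(x_k,u_k)\triangleq-\sum_{x\in\mathcal X}\sum_{y\in\mathcal Y}A^{x,x_k}(u_k)B^{x,y}(u_k)\log\big(A^{x,x_k}(u_k)B^{x,y}(u_k)\big).$$ Then the entropy-regularized problem $$\inf_{\mu\in\mathcal P}\; E_T\big[J_\mu^T+\beta H_\mu(X^T\mid Y^T,U^{T-1})+\lambda H_\mu(Y^T,U^{T-1})\big]$$ (subject to the POMDP dynamics of the context) with $\beta=\lambda\ge0$ is equivalent (up to $\beta H(X_0,Y_0)$) to $$\inf_{\bar\mu}\;E_{\bar\mu}\Big[\sum_{k=0}^\infty\gamma^kL(\pi_k,U_k)\,\Big|\,\pi_0\Big]$$ subject to $\pi_{k+1}=\Pi(\pi_k,U_k,Y_{k+1})$, $Y_{k+1}\mid \pi_k,U_k\sim p(y_{k+1}\mid\pi_k,u_k)$, and $U_k=\bar\mu(\pi_k)\in\mathcal U$, where the optimization is over deterministic, stationary policies $\bar\mu:\Delta\to\mathcal U$.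
   Context: All logarithms are base 2, with $0\log 0=0$ and terms of probability zero contributing $0$; empty sums are $0$ and empty products are $1$. Superscripts denote trajectories: $X^T=(X_0,\dots,X_T)$, $x^T=(x_0,\dots,x_T)$, and similarly for $Y^T$, $U^{T-1}$; $U^{-1}$ is empty. POMDP: finite sets $\mathcal X=\{1,\dots,N_x\}$ (states), $\mathcal U=\{1,\dots,N_u\}$ (controls), $\mathcal Y=\{1,\dots,N_y\}$ (observations); $\Delta=\{\pi\in[0,1]^{N_x}:\sum_{x\in\mathcal X}\pi(x)=1\}$; initial pmf $\rho\in\Delta$ of $X_0$; transition kernel $A^{x,\bar x}(u)=p(X_{k+1}=x\mid X_k=\bar x,U_k=u)$; observation kernel $B^{x,y}(u)=p(Y_k=y\mid X_k=x,U_{k-1}=u)$ for $k>0$ and $B^{x_0,y_0}=p(Y_0=y_0\mid X_0=x_0)$. A policy is $\mu=\{\mu_k^{i_k}:k\ge0\}$, where for each realization $i_k=(y^k,u^{k-1})$ of the information state $I_k=(Y^k,U^{k-1})$, $\mu_k^{i_k}(u_k)=p(U_k=u_k\mid Y^k=y^k,U^{k-1}=u^{k-1})$ is a pmf on $\mathcal U$; $\mathcal P$ is the set of all policies (stochastic or deterministic). Under $\mu$, $$p_\mu(x^T,y^T,u^{T-1})=\rho(x_0)B^{x_0,y_0}\prod_{k=0}^{T-1}A^{x_{k+1},x_k}(u_k)\,\mu_k^{i_k}(u_k)\,B^{x_{k+1},y_{k+1}}(u_k),$$ and $E_\mu$ is the corresponding expectation. Costs and entropies for a horizon $T\ge 0$: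 $J_\mu^T=E_\mu[c_T(X_T)+\sum_{k=0}^{T-1}c(X_k,U_k)]$ with arbitrary $c:\mathcal X\times\mathcal U\to\mathbb R$, $c_T:\mathcal X\to\mathbb R$; smoother entropy $H_\mu(X^T\mid Y^T,U^{T-1})=-E_\mu[\log p_\mu(X^T\mid Y^T,U^{T-1})]$; input-output entropy $H_\mu(Y^T,U^{T-1})=-E_\mu[\log p_\mu(Y^T,U^{T-1})]$. $H(X_0,Y_0)$ is the joint entropy of $(X_0,Y_0)$, which does not depend on $\mu$. The horizon $T$ is a random variable with geometric distribution, $P(T=t)=\gamma^t(1-\gamma)$ for $t\ge0$, with parameter $0<\gamma<1$, and $E_T$ denotes expectation over $T$. Belief state: $\pi_k\in\Delta$ with $\pi_k(x)=p(X_k=x\mid y^k,u^{k-1})$, where $\pi_0(x)=B^{x,y_0}\rho(x)/\sum_{\bar x\in\mathcal X}B^{\bar x,y_0}\rho(\bar x)$ and $\pi_{k+1}=\Pi(\pi_k,u_k,y_{k+1})$ is the Bayesian filter $$\Pi(\pi,u,y)(x)=\frac{B^{x,y}(u)\sum_{\bar x\in\mathcal X}A^{x,\bar x}(u)\pi(\bar x)}{\sum_{\underline x\in\mathcal X}\sum_{\bar x\in\mathcal X}B^{\underline x,y}(u)A^{\underline x,\bar x}(u)\pi(\bar x)},$$ and $p(y\mid\pi,u)=\sum_{x,\bar x\in\mathcal X}B^{x,y}(u)A^{x,\bar x}(u)\pi(\bar x)$. *)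

(* Defs.v *)
From HB Require Import structures.
From mathcomp Require Import all_boot all_order all_algebra.
From mathcomp Require Import all_classical all_reals all_analysis.
Set Implicit Arguments.
Unset Strict Implicit.
Unset Printing Implicit Defensive.
Import Order.TTheory GRing.Theory Num.Theory numFieldNormedType.Exports.
Local Open Scope classical_set_scope.
Local Open Scope ring_scope.

(* [ln] is [0] on nonpositive reals, so [0 * log2 0 = 0]. *)
Definition log2 (R : realType) (t : R) : R := ln t / ln 2.

Definition is_pmf (R : realType) (I : finType) (f : I -> R) : Prop :=
  (forall i, 0 <= f i) /\ \sum_i f i = 1.

Definition in_simplex (R : realType) (Nx : nat) : pred {ffun 'I_Nx -> R} :=
  fun f => [forall x, 0 <= f x <= 1] && (\sum_x f x == 1).

(* The belief simplex Delta. *)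
Definition belief (R : realType) (Nx : nat) : Type :=
  {f : {ffun 'I_Nx -> R} | in_simplex f}.

(* [trans u x' x] is A^{x',x}(u), [obs u x y] is B^{x,y}(u), and
   [obs0 x y] is B^{x,y} at time 0. *)
Record pomdp (R : realType) (Nx Nu Ny : nat) := Pomdp {
  rho : belief R Nx;
  trans : 'I_Nu -> 'I_Nx -> 'I_Nx -> R;
  obs : 'I_Nu -> 'I_Nx -> 'I_Ny -> R;
  obs0 : 'I_Nx -> 'I_Ny -> R;
  trans_pmf : forall u x, is_pmf (fun x' => trans u x' x);
  obs_pmf : forall u x, is_pmf (obs u x);
  obs0_pmf : forall x, is_pmf (obs0 x) }.

Section Pomdp.
Context (R : realType) (Nx Nu Ny : nat) (G : pomdp R Nx Nu Ny).
Local Notation X := 'I_Nx.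
Local Notation U := 'I_Nu.
Local Notation Y := 'I_Ny.
Local Notation Delta := (belief R Nx).

Local Notation cur z k := (tnth z (widen_ord (leqnSn _) k)).
Local Notation next z k := (tnth z (lift ord0 k)).

(* [mu ys us u] is mu_k^{i_k}(u) for i_k = (y^k, u^{k-1}) given as the
   sequences [ys] (of size k+1) and [us] (of size k); the values at
   other pairs of sequences are irrelevant. *)
Definition control_law : Type := seq Y -> seq U -> U -> R.

Definition is_policy (mu : control_law) : Prop :=
  forall (k : nat) (y : k.+1.-tuple Y) (u : k.-tuple U), is_pmf (mu y u).

Definition joint (mu : control_law) (T : nat)
    (x : T.+1.-tuple X) (y : T.+1.-tuple Y) (u : T.-tuple U) : R :=
  val (rho G) (tnth x ord0) * obs0 G (tnth x ord0) (tnth y ord0) *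
  \prod_(k < T)
    (trans G (tnth u k) (next x k) (cur x k) *
     mu (take k.+1 y) (take k u) (tnth u k) *
     obs G (tnth u k) (next x k) (next y k)).

Definition joint_io (mu : control_law) (T : nat)
    (y : T.+1.-tuple Y) (u : T.-tuple U) : R :=
  \sum_(x : T.+1.-tuple X) joint mu x y u.

Definition E_mu (mu : control_law) (T : nat)
    (f : T.+1.-tuple X -> T.+1.-tuple Y -> T.-tuple U -> R) : R :=
  \sum_(x : T.+1.-tuple X) \sum_(y : T.+1.-tuple Y) \sum_(u : T.-tuple U)
    joint mu x y u * f x y u.

Definition cost_J (c : X -> U -> R) (cT : X -> R) (mu : control_law)
    (T : nat) : R :=
  E_mu mu (fun (x : T.+1.-tuple X) _ (u : T.-tuple U) =>
    cT (tnth x ord_max) + \sum_(k < T) c (cur x k) (tnth u k)).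

Definition smoother_entropy (mu : control_law) (T : nat) : R :=
  - E_mu mu (fun (x : T.+1.-tuple X) y u =>
      log2 (joint mu x y u / joint_io mu y u)).

Definition io_entropy (mu : control_law) (T : nat) : R :=
  - E_mu mu (fun (_ : T.+1.-tuple X) y u => log2 (joint_io mu y u)).

Definition horizon_pmf (gamma : R) (t : nat) : R := gamma ^+ t * (1 - gamma).

Definition regularized_cost (beta lambda : R) (c : X -> U -> R)
    (cT : X -> R) (mu : control_law) (T : nat) : R :=
  cost_J c cT mu T + beta * smoother_entropy mu T + lambda * io_entropy mu T.

Definition E_T (gamma : R) (f : nat -> R) : R :=
  limn (series (fun t => horizon_pmf gamma t * f t)).

Definition entropy_X0Y0 : R :=
  - \sum_(x : X) \sum_(y : Y)
      val (rho G) x * obs0 G x y * log2 (val (rho G) x * obs0 G x y).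

Definition y0_prob (y : Y) : R := \sum_x obs0 G x y * val (rho G) x.

(* [insubd d f] is [f] when [f] lies in the simplex; the default [d] is
   returned only when the normalizing denominator, i.e. the probability of
   the observation, is zero. *)
Definition init_belief (y : Y) : Delta :=
  insubd (rho G) [ffun x => obs0 G x y * val (rho G) x / y0_prob y].

Definition obs_prob (p : Delta) (u : U) (y : Y) : R :=
  \sum_x \sum_x' obs G u x y * trans G u x x' * val p x'.

Definition bayes_filter (p : Delta) (u : U) (y : Y) : Delta :=
  insubd p [ffun x => obs G u x y * (\sum_x' trans G u x x' * val p x') /
                      obs_prob p u y].

Definition ctilde (x : X) (u : U) : R :=
  - \sum_(x' : X) \sum_(y : Y)
      trans G u x' x * obs G u x' y * log2 (trans G u x' x * obs G u x' y).

Definition stage_cost (gamma beta : R) (c : X -> U -> R) (cT : X -> R)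
    (x : X) (u : U) : R :=
  (1 - gamma) * cT x + gamma * c x u + gamma * beta * ctilde x u.

Definition belief_cost (gamma beta : R) (c : X -> U -> R) (cT : X -> R)
    (p : Delta) (u : U) : R :=
  \sum_x val p x * stage_cost gamma beta c cT x u.

(* A realization of the controlled belief process started at [p0] under the
   stationary deterministic policy [b]. [bm_Y k] is Y_{k+1}. The last field
   is the conditional law of Y_{k+1}, given that the past observations are
   those along the outcome [w] (these determine pi_0, ..., pi_k and
   U_0, ..., U_k). *)
Record belief_model (b : Delta -> U) (p0 : Delta) := BeliefModel {
  bm_disp : measure_display;
  bm_space : measurableType bm_disp;
  bm_prob : probability bm_space R;
  bm_pi : nat -> bm_space -> Delta;
  bm_U : nat -> bm_space -> U;
  bm_Y : nat -> bm_space -> Y;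
  bm_Y_meas : forall k y, measurable [set w | bm_Y k w = y];
  bm_pi0 : forall w, bm_pi 0 w = p0;
  bm_piS : forall k w,
    bm_pi k.+1 w = bayes_filter (bm_pi k w) (bm_U k w) (bm_Y k w);
  bm_UE : forall k w, bm_U k w = b (bm_pi k w);
  bm_law : forall k w y,
    let past := [set w' | forall j, (j < k)%N -> bm_Y j w' = bm_Y j w] in
    (bm_prob (past `&` [set w' | bm_Y k w' = y]) =
     bm_prob past * (obs_prob (bm_pi k w) (bm_U k w) y)%:E)%E }.

Arguments bm_pi {b p0} _ _ _.
Arguments bm_U {b p0} _ _ _.
Arguments bm_Y {b p0} _ _ _.

Definition discounted_sum (gamma beta : R) (c : X -> U -> R) (cT : X -> R)
    (b : Delta -> U) (p0 : Delta) (m : belief_model b p0) (w : bm_space m) : R :=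
  limn (series (fun k =>
    gamma ^+ k * belief_cost gamma beta c cT (bm_pi m k w) (bm_U m k w))).

Definition discounted_cost (gamma beta : R) (c : X -> U -> R) (cT : X -> R)
    (b : Delta -> U) (p0 : Delta) (m : belief_model b p0) : \bar R :=
  ('E_(bm_prob m)[@discounted_sum gamma beta c cT b p0 m])%E.

(* The belief pi_k along the information state (y^k, u^{k-1}); the value at
   the empty observation sequence is irrelevant. *)
Definition history_belief (ys : seq Y) (us : seq U) : Delta :=
  if ys is y0 :: ys' then
    foldl (fun p uy => bayes_filter p uy.1 uy.2) (init_belief y0) (zip us ys')
  else rho G.

Definition induced_policy (b : Delta -> U) : control_law :=
  fun ys us u => (u == b (history_belief ys us))%:R.

End Pomdp.

Arguments bm_pi {R Nx Nu Ny G b p0} _ _ _.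
Arguments bm_U {R Nx Nu Ny G b p0} _ _ _.
Arguments bm_Y {R Nx Nu Ny G b p0} _ _ _.
Arguments discounted_sum {R Nx Nu Ny G} gamma beta c cT {b p0} m w.

(* Every belief model exists: observations with prescribed conditional laws
   are read off a uniform variable on [0, 1[ through nested intervals. *)
Section Existence.
Context (R : realType) (Ny : nat) (y0 : 'I_Ny) (q : seq 'I_Ny -> 'I_Ny -> R)
  (q_pmf : forall s, is_pmf (q s)).
Local Notation Y := 'I_Ny.

Let F s (n : nat) : R := \sum_(z : Y | (z < n)%N) q s z.

Let F0 s : F s 0 = 0.
Proof. by rewrite /F big_pred0. Qed.

Let FN s : F s Ny = 1.
Proof.
by have [_ <-] := q_pmf s; rewrite /F; apply: eq_bigl => z; rewrite ltn_ord.
Qed.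

Let FS s (y : Y) : F s y.+1 = F s y + q s y.
Proof.
rewrite /F (bigD1 y) //= addrC; congr (_ + _); apply: eq_bigl => z.
by rewrite ltnS andbC [in RHS]ltn_neqAle.
Qed.

Let F_mono s m n : (m <= n)%N -> F s m <= F s n.
Proof.
have [q0 _] := q_pmf s; elim: n => [|n IHn]; first by rewrite leqn0 => /eqP ->.
rewrite leq_eqVlt => /orP[/eqP -> //|]; rewrite ltnS => /IHn /le_trans; apply.
have [nN|Nn] := ltnP n Ny; first by rewrite (FS s (Ordinal nN)) lerDl.
rewrite /F le_eqVlt; apply/orP; left; apply/eqP; apply: eq_bigl => z.
by rewrite ltnS (leq_trans (ltn_ord z) Nn) (ltnW (leq_trans (ltn_ord z) Nn)).
Qed.

(* Histories are listed latest observation first. *)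
Let len := fix len s : R := if s is y :: s' then len s' * q s' y else 1.
Let lo := fix lo s : R := if s is y :: s' then lo s' + len s' * F s' y else 0.
Let I s : set R := [set` `[lo s, lo s + len s[%R].

Let len_ge0 s : 0 <= len s.
Proof. by elim: s => //= y s IHs; rewrite mulr_ge0 //; case: (q_pmf s). Qed.

Let I_cons y s x : I (y :: s) x <->
  (lo s + len s * F s y <= x < lo s + len s * F s y.+1).
Proof. by rewrite /I /= in_itv /= FS mulrDr addrA. Qed.

Let I_sub y s : I (y :: s) `<=` I s.
Proof.
move=> x /I_cons /andP[h1 h2]; rewrite /I /= in_itv /=; apply/andP; split.
  apply: le_trans h1; rewrite lerDl mulr_ge0 //.
  by rewrite -(F0 s); apply: F_mono.
apply: (lt_le_trans h2); rewrite lerD2l -[leRHS]mulr1 ler_wpM2l // -(FN s).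
exact: F_mono.
Qed.

Let I_disj y z s x : I (y :: s) x -> I (z :: s) x -> y = z.
Proof.
have aux (y' z' : Y) : x < lo s + len s * F s y'.+1 ->
    lo s + len s * F s z' <= x -> (z' <= y')%N.
  move=> h1 h2; rewrite leqNgt; apply/negP => h.
  have := lt_le_trans h1 (le_trans _ h2); rewrite ltxx => H; apply: notF; apply: H.
  by rewrite lerD2l ler_wpM2l // F_mono.
move=> /I_cons /andP[y1 y2] /I_cons /andP[z1 z2]; apply/val_inj/eqP.
by rewrite eqn_leq (aux _ _ z2 y1) (aux _ _ y2 z1).
Qed.

Let I_cover s x : I s x -> exists y, I (y :: s) x.
Proof.
rewrite /I /= in_itv /= => /andP[h1 h2].
have ex : exists n, x < lo s + len s * F s n by exists Ny; rewrite FN mulr1.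
case: (ex_minnP ex) => -[|n] hn hmin.
  by move: hn; rewrite F0 mulr0 addr0 ltNge h1.
have nN : (n < Ny)%N by apply: hmin; rewrite FN mulr1.
exists (Ordinal nN); apply/I_cons; rewrite hn andbT leNgt; apply/negP => h.
by have := hmin _ h; rewrite ltnn.
Qed.

Let nxt (s : seq Y) (x : R) : Y :=
  if [pick y | `[< I (y :: s) x >]] is Some y then y else y0.
Let hist (n : nat) (x : R) : seq Y := iter n (fun s => nxt s x :: s) [::].
Let Yp (k : nat) (x : R) : Y := nxt (hist k x) x.

Let hist_size n x : size (hist n x) = n.
Proof. by elim: n => //= n ->. Qed.

Let nxtP y s x : I (y :: s) x -> nxt s x = y.
Proof.
move=> h; rewrite /nxt; case: pickP => [z /asboolP hz|/(_ y)].
  exact: I_disj hz h.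
by move/asboolP.
Qed.

Let hist_I s x : I s x -> hist (size s) x = s.
Proof.
elim: s => //= y s IHs h; rewrite -/(hist _ _) (IHs (I_sub h)).
by rewrite (nxtP h).
Qed.

Let I_hist n x : I [::] x -> I (hist n x) x.
Proof.
move=> h; elim: n => //= n /I_cover[y hy].
by rewrite -/(hist _ _) (nxtP hy).
Qed.

Let I_root s : I s `<=` I [::].
Proof. by elim: s => // y s IHs; apply: subset_trans IHs; exact: I_sub. Qed.

Let hist_out n x : ~ I [::] x -> hist n x = nseq n y0.
Proof.
move=> h; elim: n => //= n; rewrite -/(hist _ _) => ->; congr (_ :: _).
by rewrite /nxt; case: pickP => // y /asboolP /I_root.
Qed.

Let histE s : [set x | hist (size s) x = s] `&` I [::] = I s.
Proof.
apply/seteqP; split=> x /=; first by move=> [<- hx]; exact: I_hist.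
by move=> h; split; [exact: hist_I|exact: I_root h].
Qed.

Let mI s : measurable (I s).
Proof. exact: measurable_itv. Qed.

Let mhist n s : measurable [set x | hist n x = s].
Proof.
have [->|ns] := eqVneq n (size s); last first.
  rewrite (_ : [set _ | _] = set0) //; apply/seteqP; split=> // x /= h.
  by move: ns; rewrite -h hist_size eqxx.
rewrite (_ : [set _ | _] = I s `|`
  (if s == nseq (size s) y0 then ~` I [::] else set0)).
  by apply: measurableU => //; case: ifP => // _; exact: measurableC.
rewrite -histE; apply/seteqP; split=> x /=.
  have [h|h] := pselect (I [::] x); first by left.
  by rewrite (hist_out _ h) => e; right; rewrite {1}e eqxx.
by case=> [[]//|]; case: eqP => // e h; rewrite (hist_out _ h) -e.
Qed.

Let unif : set (measurableTypeR R) -> \bar R := mrestr (@lebesgue_measure R) (mI [::]).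

Let unifT : unif setT = 1%E.
Proof.
by rewrite /unif /mrestr setTI /I lebesgue_measure_itv /= add0r lte01 oppr0 adde0.
Qed.

Let unif_I s : unif [set x | hist (size s) x = s] = (len s)%:E.
Proof.
rewrite /unif /mrestr histE /I lebesgue_measure_itv /= lte_fin ltrDl.
rewrite -EFinB addrAC subrr add0r.
by case: ltP => // h; congr EFin; apply/eqP; rewrite eq_le h len_ge0.
Qed.

HB.instance Definition _ := Measure.on unif.
HB.instance Definition _ := Measure_isProbability.Build _ _ _ unif unifT.

Let past k w : [set w' | forall j, (j < k)%N -> Yp j w' = Yp j w] =
  [set w' | hist k w' = hist k w].
Proof.
apply/seteqP; split=> w' /=; elim: k => //= k IHk.
  move=> h; rewrite -!/(hist _ _) -!/(Yp _ _) h // IHk // => j jk.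
  by apply: h; rewrite ltnS ltnW.
rewrite -!/(hist _ _) => -[h1 h2] j; rewrite ltnS leq_eqVlt => /orP[/eqP ->//|].
exact: IHk.
Qed.

Lemma sequential_choice :
  exists (P : probability (measurableTypeR R) R) (H : nat -> R -> seq Y) (Yp : nat -> R -> Y),
  [/\ forall w, H 0 w = [::], forall k w, H k.+1 w = Yp k w :: H k w,
      forall k y, measurable [set w | Yp k w = y] &
  forall k w y,
    (P ([set w' | forall j, (j < k)%N -> Yp j w' = Yp j w] `&`
        [set w' | Yp k w' = y]) =
     P [set w' | forall j, (j < k)%N -> Yp j w' = Yp j w] *
     (q (H k w) y)%:E)%E].
Proof.
exists unif, hist, Yp; split=> // [k y|k w y].
  rewrite (_ : [set _ | _] =
    \bigcup_(s in [set: seq Y]) [set w | hist k.+1 w = y :: s]).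
    by apply: countable_bigcupT_measurable => // s; exact: mhist.
  apply/seteqP; split=> w /=; first by move=> <-; exists (hist k w).
  by case=> s _ [].
rewrite past.
have -> : [set w' | hist k w' = hist k w] `&` [set w' | Yp k w' = y] =
          [set w' | hist k.+1 w' = y :: hist k w].
  apply/seteqP; split=> w' /=; first by move=> [h1 h2]; rewrite -h2 -h1.
  by move=> [h1 h2]; split.
have := unif_I (y :: hist k w); have := unif_I (hist k w).
by rewrite /= hist_size => -> ->.
Qed.
End Existence.

Section ModelExists.
Context (R : realType) (Nx Nu Ny : nat) (G : pomdp R Nx Nu Ny).

Lemma obs_prob_pmf (p : belief R Nx) (u : 'I_Nu) : is_pmf (obs_prob G p u).
Proof.
have /andP[/forallP p01 /eqP p1] := valP p; split=> [y|].
  apply: sumr_ge0 => x _; apply: sumr_ge0 => x' _.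
  have [hO _] := obs_pmf G u x; have [hT _] := trans_pmf G u x'.
  by rewrite !mulr_ge0 //; case/andP: (p01 x').
rewrite exchange_big /= -[RHS]p1.
under eq_bigr do rewrite exchange_big /=.
rewrite exchange_big /=; apply: eq_bigr => x' _.
under eq_bigr => x _.
  under eq_bigr do rewrite -mulrA.
  rewrite -mulr_suml (obs_pmf G u x).2 mul1r.
  over.
by rewrite -mulr_suml (trans_pmf G u x').2 mul1r.
Qed.

Lemma belief_model_exists (b : belief R Nx -> 'I_Nu) (p0 : belief R Nx) :
  inhabited (belief_model G b p0).
Proof.
pose bel := fix bel s : belief R Nx :=
  if s is y :: s' then bayes_filter G (bel s') (b (bel s')) y else p0.
case: (pickP 'I_Ny) => [y0 _|none]; last first.
  have [_ psum] := obs_prob_pmf p0 (b p0).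
  by move/eqP: psum; rewrite big_pred0 // eq_sym oner_eq0.
have [P [H [Yp [H0 HS mY law]]]] :=
  sequential_choice y0 (fun s => obs_prob_pmf (bel s) (b (bel s))).
constructor; apply: (@BeliefModel _ _ _ _ G b p0 _ _ P
  (fun k w => bel (H k w)) (fun k w => b (bel (H k w))) Yp) => //.
- by move=> w; rewrite H0.
- by move=> k w; rewrite HS.
Qed.
End ModelExists.

(* Main.v *)
(** Along any policy the joint law of the trajectory factors into the law of
(X_0,Y_0), the kernels A and B, and the control laws. As beta = lambda, the two
entropies add up to the joint entropy, which the chain rule turns into
H(X_0,Y_0), the additive stage cost [ctilde], and the conditional entropies of
the controls. The latter are nonnegative and vanish for deterministic policies.
Averaging over the geometric horizon gives a discounted sum whose k-th term is
the mean of L(pi_k,U_k) plus gamma * beta times a control entropy.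

The Bellman operator of the belief problem is a contraction of the bounded
functions on the simplex, without any regularity in the belief, because there
are finitely many controls and observations. Its fixed point V satisfies
V(p) <= L(p,u) + gamma E[V(Pi(p,u,Y))], with equality at a greedy control.
Telescoping gamma^k E[V(pi_k)] shows that V is a lower bound for every policy,
history-dependent or randomized. The same telescoping with the fixed point W_b
of a stationary policy b evaluates both the policy of the POMDP induced by b
and the belief model of b. *)

Require Import Defs.
From HB Require Import structures.
From mathcomp Require Import all_boot all_order all_algebra.
From mathcomp Require Import all_classical all_reals all_analysis.
From mathcomp Require Import measurable_realfun ring lra.
Set Implicit Arguments.
Unset Strict Implicit.
Unset Printing Implicit Defensive.
Import Order.TTheory GRing.Theory Num.Theory numFieldNormedType.Exports.
Local Open Scope classical_set_scope.
Local Open Scope ring_scope.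

(** * Discounted series and contractions *)

Section Discounting.
Context (R : realType) (g : R) (g_gt0 : 0 < g) (g_lt1 : g < 1).

Let g_norm : `|g| < 1.
Proof. by rewrite gtr0_norm. Qed.

Let gX_ge0 n : 0 <= g ^+ n.
Proof. by rewrite exprn_ge0 // ltW. Qed.

Lemma discounted_normed_cvg (u : R^nat) (C : R) : (forall k, `|u k| <= C) ->
  cvgn [normed series (fun k => g ^+ k * u k)].
Proof.
move=> uC; apply: (@series_le_cvg _ _ (geometric C g)) => [n|n|n|].
- exact: normr_ge0.
- by rewrite /= mulr_ge0 //; apply: le_trans (uC 0).
- by rewrite /= normrM ger0_norm //= mulrC ler_wpM2r.
- exact: is_cvg_geometric_series.
Qed.

Lemma discounted_cvg (u : R^nat) (C : R) : (forall k, `|u k| <= C) ->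
  cvgn (series (fun k => g ^+ k * u k)).
Proof. by move=> uC; apply: normed_cvg; exact: discounted_normed_cvg uC. Qed.

Lemma discounted_cvg0 (u : R^nat) (C : R) : (forall k, `|u k| <= C) ->
  (fun k => g ^+ k * u k) @ \oo --> (0 : R).
Proof. by move=> uC; apply: cvg_series_cvg_0; exact: discounted_cvg uC. Qed.

Lemma discounted_sum_le (u : R^nat) (C : R) n : (forall k, `|u k| <= C) ->
  `|series (fun k => g ^+ k * u k) n| <= C / (1 - g).
Proof.
move=> uC; have C0 : 0 <= C by apply: le_trans (uC 0).
apply: (le_trans (ler_norm_sum _ _ _)).
apply: le_trans (geometric_le_lim n C0 g_gt0 g_norm).
apply: ler_sum => k _.
by rewrite normrM ger0_norm //= mulrC ler_wpM2r.
Qed.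

(** Turns an inequality that can be iterated with a factor [g] into a sign. It gives the fixed point
    equation below and the comparison of value functions. *)
Lemma le_geometric_le0 (x C : R) : (forall n, x <= C * g ^+ n) -> x <= 0.
Proof.
by move=> h; apply: (cvgr_to_ge (cvg_geometric C g_norm)); exact: nearW.
Qed.

Lemma telescoping_series (u v : R^nat) n :
  (forall k, u k = v k - g * v k.+1) ->
  series (fun k => g ^+ k * u k) n = v 0 - g ^+ n * v n.
Proof.
move=> uv; rewrite /series /=; elim: n => [|n IHn].
  by rewrite big_geq // expr0 mul1r subrr.
by rewrite big_nat_recr //= IHn uv exprS; ring.
Qed.

Lemma discounted_telescope (u v : R^nat) (C : R) : (forall k, `|v k| <= C) ->
  (forall k, u k = v k - g * v k.+1) ->
  series (fun k => g ^+ k * u k) @ \oo --> v 0.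
Proof.
move=> vC uv.
have -> : series (fun k => g ^+ k * u k) = (fun n => v 0 - g ^+ n * v n).
  by apply/funext => n; exact: telescoping_series.
rewrite -[X in _ --> X](subr0 (v 0)); apply: cvgB; first exact: cvg_cst.
exact: discounted_cvg0 vC.
Qed.

(** The discounted sums of [u] dominate those of [v k - g * v k.+1], which telescope; their
    remainder [g ^+ n * v n] vanishes because [v] is bounded. *)
Lemma discounted_telescope_ge (u v : R^nat) (C D : R) :
  (forall k, `|u k| <= D) -> (forall k, `|v k| <= C) ->
  (forall k, v k - g * v k.+1 <= u k) ->
  v 0 <= limn (series (fun k => g ^+ k * u k)).
Proof.
move=> uD vC uv.
have h := discounted_telescope vC (fun k => erefl (v k - g * v k.+1)).
rewrite -(cvg_lim (@Rhausdorff R) h).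
apply: ler_lim; [by apply/cvg_ex; exists (v 0)|exact: discounted_cvg uD|].
by apply: nearW => n; apply: ler_sum => k _; rewrite ler_wpM2l.
Qed.

(** Summation by parts. The cost [a k] is charged with probability P(k < T < n) = g^(k+1) - g^n; the
    first part enters the discounted series and the second is the boundary term. *)
Lemma horizon_partial_sum (a d : R^nat) (h : R) n :
  series (fun t => horizon_pmf g t * (h + \sum_(0 <= k < t) a k + d t)) n =
  h * (1 - g ^+ n) + series (fun k => g ^+ k * ((1 - g) * d k + g * a k)) n
  - g ^+ n * \sum_(0 <= k < n) a k.
Proof.
rewrite /series /= /horizon_pmf; elim: n => [|n IHn].
  by rewrite !big_geq // expr0; ring.
by rewrite !big_nat_recr //= IHn exprS; ring.
Qed.

(** For constant nonnegative data the partial sums increase and the previous identity bounds them.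
    This series dominates the general one. *)
Let horizon_abs_cvg (H A D : R) : 0 <= H -> 0 <= A -> 0 <= D ->
  cvgn (series (fun t => horizon_pmf g t * (H + \sum_(0 <= k < t) A + D))).
Proof.
move=> H0 A0 D0; apply: nondecreasing_is_cvgn.
  apply: nondecreasing_series => n _ _.
  rewrite /horizon_pmf mulr_ge0 ?mulr_ge0 ?subr_ge0 ?(ltW g_lt1) //.
  by rewrite !addr_ge0 // sumr_ge0.
exists (H + ((1 - g) * D + g * A) / (1 - g)) => _ [n _ <-].
rewrite (horizon_partial_sum (fun=> A) (fun=> D)).
have B0 : 0 <= (1 - g) * D + g * A.
  by rewrite addr_ge0 ?mulr_ge0 ?subr_ge0 ?(ltW g_lt1) ?(ltW g_gt0).
have /ler_normlW h1 : `|series (fun k => g ^+ k * ((1 - g) * D + g * A)) n|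
    <= ((1 - g) * D + g * A) / (1 - g).
  by apply: discounted_sum_le => _; rewrite ger0_norm.
have h2 : 0 <= g ^+ n * \sum_(0 <= k < n) A by rewrite mulr_ge0 // sumr_ge0.
have h3 : H * (1 - g ^+ n) <= H by rewrite mulrBr mulr1 gerBl mulr_ge0.
by lra.
Qed.

Section Horizon.
Context (a d : R^nat) (h A D : R).
Hypotheses (aA : forall k, `|a k| <= A) (dD : forall k, `|d k| <= D).
Let f t := h + \sum_(0 <= k < t) a k + d t.

Let A0 : 0 <= A. Proof. exact: le_trans (aA 0). Qed.
Let D0 : 0 <= D. Proof. exact: le_trans (dD 0). Qed.

Lemma horizon_normed_cvg : cvgn [normed series (fun t => horizon_pmf g t * f t)].
Proof.
apply: series_le_cvg (horizon_abs_cvg (normr_ge0 h) A0 D0).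
- by move=> n; exact: normr_ge0.
- move=> n; rewrite /horizon_pmf mulr_ge0 ?mulr_ge0 ?subr_ge0 ?(ltW g_lt1) //.
  by rewrite !addr_ge0 // sumr_ge0.
move=> n; have hp : 0 <= horizon_pmf g n.
  by rewrite /horizon_pmf mulr_ge0 ?subr_ge0 ?(ltW g_lt1).
rewrite /= normrM (ger0_norm hp); apply: ler_wpM2l => //.
apply: (le_trans (ler_normD _ _)); rewrite lerD //.
apply: (le_trans (ler_normD _ _)); rewrite lerD //.
by apply: (le_trans (ler_norm_sum _ _ _)); apply: ler_sum.
Qed.

Lemma horizon_expectation : E_T g f =
  h + limn (series (fun k => g ^+ k * ((1 - g) * d k + g * a k))).
Proof.
have bC k : `|(1 - g) * d k + g * a k| <= (1 - g) * D + g * A.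
  apply: (le_trans (ler_normD _ _)); rewrite !normrM (ger0_norm (ltW g_gt0)).
  by rewrite ger0_norm ?subr_ge0 ?(ltW g_lt1) // lerD // ler_wpM2l ?subr_ge0 ?(ltW g_lt1) ?(ltW g_gt0).
have c1 := discounted_cvg bC.
apply/cvg_lim; first exact: Rhausdorff.
have -> : series (fun t => horizon_pmf g t * f t) = (fun n =>
    h * (1 - g ^+ n) + series (fun k => g ^+ k * ((1 - g) * d k + g * a k)) n
    - g ^+ n * \sum_(0 <= k < n) a k).
  by apply/funext => n; exact: horizon_partial_sum.
rewrite -[X in _ --> X]subr0; apply: cvgB; last first.
  (* The terms of the convergent series with [H = D = 0] tend to 0. Up to the factor [1 - g] they
     are [g ^+ n] times a sum of [n] copies of [A], which bounds the boundary term. *)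
  have /cvg_series_cvg_0 hc := horizon_abs_cvg (lexx 0) A0 (lexx 0).
  apply: (@squeeze_cvgr _ \oo _ _
    (fun n => - (1 - g)^-1 * (horizon_pmf g n * (0 + \sum_(0 <= k < n) A + 0)))
    (fun n => (1 - g)^-1 * (horizon_pmf g n * (0 + \sum_(0 <= k < n) A + 0)))).
  - apply: nearW => n; rewrite mulNr -ler_norml add0r addr0 /horizon_pmf.
    have -> : (1 - g)^-1 * (g ^+ n * (1 - g) * \sum_(0 <= k < n) A) =
        g ^+ n * \sum_(0 <= k < n) A.
      by field; rewrite subr_eq0 gt_eqF.
    rewrite normrM ger0_norm // ler_wpM2l //.
    by apply: (le_trans (ler_norm_sum _ _ _)); apply: ler_sum.
  - by rewrite -[X in _ --> X](mulr0 (- (1 - g)^-1)); apply: cvgM => //; exact: cvg_cst.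
  - by rewrite -[X in _ --> X](mulr0 (1 - g)^-1); apply: cvgM => //; exact: cvg_cst.
apply: cvgD; last exact: c1.
rewrite -[X in _ --> X]mulr1 -[X in _ * X]subr0.
apply: cvgM; first exact: cvg_cst.
by apply: cvgB; [exact: cvg_cst|exact: cvg_expr].
Qed.

End Horizon.

(** Picard iteration from the zero function. Limits are taken pointwise while the estimates are
    uniform in the point, so [T] can be an arbitrary type. *)
Lemma contraction_fixpoint (T : Type) (F : (T -> R) -> T -> R) (C : R) :
  (forall p, `|F (fun=> 0) p| <= C) ->
  (forall V W e, (forall p, `|V p - W p| <= e) ->
     forall p, `|F V p - F W p| <= g * e) ->
  exists2 V : T -> R, (forall p, `|V p| <= C / (1 - g)) &
    forall p, V p = F V p.
Proof.
move=> F0 Fcontr; pose v n := iter n F (fun=> 0).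
have dv n p : `|v n.+1 p - v n p| <= C * g ^+ n.
  elim: n p => [|n IHn] p; first by rewrite expr0 mulr1 subr0 F0.
  by rewrite exprS mulrCA; apply: Fcontr.
have vE n p : v n p = series (fun k => v k.+1 p - v k p) n.
  by rewrite /series /= telescope_sumr // subr0.
have vB n p : `|v n p| <= C / (1 - g).
  rewrite vE; apply: (le_trans (ler_norm_sum _ _ _)).
  have C0 : 0 <= C by apply: le_trans (F0 p).
  apply: le_trans (geometric_le_lim n C0 g_gt0 g_norm).
  by apply: ler_sum => k _; exact: dv.
have vc p : cvgn (v ^~ p).
  rewrite (_ : v ^~ p = series (fun k => v k.+1 p - v k p)); last exact/funext.
  apply: normed_cvg; apply: (@series_le_cvg _ _ (geometric C g)) => [n|n|n|].
  - exact: normr_ge0.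
  - by rewrite /= mulr_ge0 //; apply: le_trans (F0 p).
  - exact: dv.
  - exact: is_cvg_geometric_series.
pose V p := limn (v ^~ p).
(* [F] is applied [n] times to both [v m] and [v 0 = 0], whose distance is at most [C / (1 - g)] by
   [vB]. *)
have dist m n p : `|v (n + m)%N p - v n p| <= C / (1 - g) * g ^+ n.
  elim: n p => [|n IHn] p; first by rewrite expr0 mulr1 subr0.
  by rewrite exprS mulrCA addSn; apply: Fcontr.
have Vdist n p : `|V p - v n p| <= C / (1 - g) * g ^+ n.
  have hc : `|v m p - v n p| @[m --> \oo] --> `|V p - v n p|.
    by apply: cvg_norm; apply: cvgB; [exact: vc|exact: cvg_cst].
  apply: (cvgr_to_le hc).
  near=> m; rewrite -(@subnKC n m) //; near: m; exact: nbhs_infty_ge.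
exists V => p.
  have hc : `|v m p| @[m --> \oo] --> `|V p| by apply: cvg_norm; exact: vc.
  by apply: (cvgr_to_le hc); exact: nearW.
apply/eqP; rewrite -subr_eq0 -normr_le0.
(* Both [V] and [F V] lie within [C / (1 - g) * g ^+ n.+1] of [v n.+1]. *)
apply: (@le_geometric_le0 _ (2 * (C / (1 - g)) * g)) => n.
rewrite -(subrKA (v n.+1 p)).
apply: (le_trans (ler_normD _ _)).
have h1 := Vdist n.+1 p.
have h2 : `|v n.+1 p - F V p| <= g * (C / (1 - g) * g ^+ n).
  by apply: (Fcontr (v n)) => q; rewrite distrC.
by move: h1 h2; rewrite exprS; lra.
Unshelve. all: by end_near.
Qed.

End Discounting.

(** * Probability mass functions, tuples and beliefs *)

Lemma log2M (R : realType) (a b : R) : 0 < a -> 0 < b ->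
  log2 (a * b) = log2 a + log2 b.
Proof. by move=> a0 b0; rewrite /log2 lnM ?posrE // mulrDl. Qed.

(** From ln s <= s at s = 1/t: t ln(1/t) <= 1. This crude estimate bounds the control entropies
    uniformly in time. *)
Lemma neg_mul_log2_le (R : realType) (t : R) : 0 <= t -> - (t * log2 t) <= (ln 2)^-1.
Proof.
have l2 : 0 < ln 2 :> R by rewrite ln_gt0 // ltr1n.
rewrite le_eqVlt => /predU1P[<-|t0]; first by rewrite mul0r oppr0 invr_ge0 ltW.
rewrite /log2 mulrA -mulNr ler_pdivrMr // mulVf ?gt_eqF // -mulrN -lnV ?posrE //.
have h : ln t^-1 <= t^-1 by apply/ltW/ln_sublinear; rewrite invr_gt0.
by rewrite -(mulfV (lt0r_neq0 t0)) ler_wpM2l ?(ltW t0).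
Qed.

Lemma mul_log2_le0 (R : realType) (t : R) : 0 <= t -> t <= 1 -> t * log2 t <= 0.
Proof.
move=> t0 t1; rewrite mulr_ge0_le0 // /log2 mulr_le0_ge0 ?ln_le0 //.
by rewrite invr_ge0 ln_ge0 // ler1n.
Qed.

Section Pmf.
Context (R : realType) (I : finType) (p : I -> R) (p_pmf : is_pmf p).

Lemma pmf_ge0 i : 0 <= p i.
Proof. by case: p_pmf => ->. Qed.

Lemma pmf_le1 i : p i <= 1.
Proof.
have [p0 <-] := p_pmf; rewrite (bigD1 i) //= lerDl.
by apply: sumr_ge0 => j _.
Qed.

Lemma pmf_sum_const (c : R) : \sum_i p i * c = c.
Proof. by rewrite -mulr_suml; case: p_pmf => _ ->; rewrite mul1r. Qed.

Lemma pmf_mean_le (f : I -> R) (C : R) : (forall i, `|f i| <= C) ->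
  `|\sum_i p i * f i| <= C.
Proof.
move=> fC; rewrite -[leRHS]pmf_sum_const; apply: (le_trans (ler_norm_sum _ _ _)).
by apply: ler_sum => i _; rewrite normrM ger0_norm ?pmf_ge0 // ler_wpM2l ?pmf_ge0.
Qed.
End Pmf.

(** * Trajectories with their last entry split off *)

Section TupleRcons.
Context (T : Type) (n : nat).
Implicit Types (t : n.-tuple T) (a : T).

Lemma tnth_rcons t a (i : 'I_n.+1) (j : 'I_n) : i = j :> nat ->
  tnth (rcons_tuple t a) i = tnth t j.
Proof.
by move=> ij; rewrite !(tnth_nth a) /= nth_rcons size_tuple ij ltn_ord.
Qed.

Lemma tnth_rcons_max t a (i : 'I_n.+1) : i = n :> nat ->
  tnth (rcons_tuple t a) i = a.
Proof.
by move=> ij; rewrite !(tnth_nth a) /= nth_rcons size_tuple ij ltnn eqxx.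
Qed.

Lemma tuple_rcons_eq (s : n.+1.-tuple T) : exists t a, s = rcons_tuple t a.
Proof.
have := size_tuple s; case/lastP E: (tval s) => [//|s' a].
rewrite size_rcons => -[/eqP e]; exists (Tuple e), a.
by apply: val_inj; rewrite /= E.
Qed.

Lemma take_rcons t a k : (k <= n)%N -> take k (rcons t a) = take k t.
Proof. by move=> kn; rewrite -cats1 takel_cat // size_tuple. Qed.
End TupleRcons.

Lemma sum_tuple0 (R : zmodType) (T : finType) (F : 0.-tuple T -> R) :
  \sum_t F t = F [tuple].
Proof.
rewrite (bigD1 [tuple]) //= big1 ?addr0 // => t.
by case/eqP; exact: tuple0.
Qed.

(** Appending an entry is an injection between finite sets of equal cardinality. Every induction on
    the horizon rests on this reindexing. *)
Lemma sum_tuple_rcons (R : zmodType) (T : finType) n (F : n.+1.-tuple T -> R) :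
  \sum_t F t = \sum_(t : n.-tuple T) \sum_a F (rcons_tuple t a).
Proof.
rewrite pair_big /= (reindex (fun p : n.-tuple T * T => rcons_tuple p.1 p.2)) //=.
apply: onW_bij; apply: inj_card_bij; last first.
  by rewrite card_prod !card_tuple expnSr.
move=> [t a] [s b] /= /(congr1 val) /= /rcons_inj[/val_inj -> ->].
by [].
Qed.

Lemma sum_tuple1 (R : zmodType) (T : finType) (F : 1.-tuple T -> R) :
  \sum_t F t = \sum_a F [tuple a].
Proof.
rewrite sum_tuple_rcons sum_tuple0; apply: eq_bigr => a _; congr F.
exact: val_inj.
Qed.

(** * Beliefs and the Bayesian filter *)

Section Belief.
Context (R : realType) (Nx Nu Ny : nat) (G : pomdp R Nx Nu Ny).
Local Notation Delta := (belief R Nx).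
Implicit Types p : Delta.

Lemma in_simplex_pmf (f : {ffun 'I_Nx -> R}) : is_pmf f -> in_simplex f.
Proof.
move=> fp; apply/andP; split; last by apply/eqP; case: fp.
by apply/forallP => x; rewrite pmf_ge0 // pmf_le1.
Qed.

Lemma belief_pmf p : is_pmf (val p).
Proof.
have /andP[/forallP p01 /eqP p1] := valP p; split=> // x.
by case/andP: (p01 x).
Qed.

(** If the total weight is 0, every weight is 0 and the default [d] is multiplied by 0. In this
    product form Bayes' rule therefore holds also for observations of probability zero. *)
Lemma bayes_normalization (w : 'I_Nx -> R) (d : Delta) x :
  (forall x, 0 <= w x) ->
  (\sum_x w x) * val (insubd d [ffun x => w x / \sum_x w x]) x = w x.
Proof.
move=> w0; have [s0|s0] := eqVneq (\sum_x w x) 0.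
  rewrite s0 mul0r; apply/esym/eqP; move/eqP: s0.
  by rewrite psumr_eq0 // => /allP /(_ x); rewrite mem_index_enum => /(_ isT).
have fs : in_simplex [ffun x => w x / \sum_x w x].
  apply: in_simplex_pmf; split=> [x'|].
    by rewrite ffunE divr_ge0 // sumr_ge0.
  by under eq_bigr do rewrite ffunE; rewrite -mulr_suml mulfV.
rewrite /insubd insubT /= ffunE mulrCA mulfV // mulr1.
by [].
Qed.

Lemma obs_probE p u y :
  obs_prob G p u y =
  \sum_x obs G u x y * \sum_x' trans G u x x' * val p x'.
Proof.
apply: eq_bigr => x _; rewrite mulr_sumr.
by apply: eq_bigr => x' _; rewrite mulrA.
Qed.

Lemma bayes_filterE p u y x :
  obs_prob G p u y * val (bayes_filter G p u y) x =
  obs G u x y * \sum_x' trans G u x x' * val p x'.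
Proof.
rewrite /bayes_filter obs_probE.
have w0 x0 : 0 <= obs G u x0 y * \sum_x' trans G u x0 x' * val p x'.
  rewrite mulr_ge0 ?(pmf_ge0 (obs_pmf _ _ _)) // sumr_ge0 // => x'' _.
  by rewrite mulr_ge0 ?(pmf_ge0 (trans_pmf _ _ _)) ?(pmf_ge0 (belief_pmf _)).
exact: (bayes_normalization p x w0).
Qed.

Lemma init_beliefE y x :
  y0_prob G y * val (init_belief G y) x = obs0 G x y * val (rho G) x.
Proof.
have w0 x0 : 0 <= obs0 G x0 y * val (rho G) x0.
  by rewrite mulr_ge0 ?(pmf_ge0 (obs0_pmf _ _)) ?(pmf_ge0 (belief_pmf _)).
exact: (bayes_normalization (rho G) x w0).
Qed.

Lemma y0_prob_pmf : is_pmf (y0_prob G).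
Proof.
split=> [y|].
  apply: sumr_ge0 => x _.
  by rewrite mulr_ge0 ?(pmf_ge0 (obs0_pmf _ _)) ?(pmf_ge0 (belief_pmf _)).
rewrite exchange_big /= -[RHS](proj2 (belief_pmf (rho G))).
by apply: eq_bigr => x _; rewrite -mulr_suml (obs0_pmf G x).2 mul1r.
Qed.

Lemma history_belief_rcons n (y : n.+1.-tuple 'I_Ny) (u : n.-tuple 'I_Nu) y' u' :
  history_belief G (rcons y y') (rcons u u') =
  bayes_filter G (history_belief G y u) u' y'.
Proof.
case: y => -[//|y0 ys] /= /eqP[sz].
rewrite -!cats1 zip_cat ?sz ?size_tuple // foldl_cat //.
Qed.
End Belief.

(** * The law of the information state *)

Section Policy.
Context (R : realType) (Nx Nu Ny : nat) (G : pomdp R Nx Nu Ny).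
Context (mu : control_law R Nu Ny) (mu_policy : is_policy mu).
Local Notation X := 'I_Nx.
Local Notation U := 'I_Nu.
Local Notation Y := 'I_Ny.
Local Notation Delta := (belief R Nx).
Local Notation last_state x := (tnth x ord_max).

Definition belief_mean (p : Delta) (h : X -> R) : R := \sum_x val p x * h x.

Definition E_io T (F : T.+1.-tuple Y -> T.-tuple U -> R) : R :=
  \sum_(y : T.+1.-tuple Y) \sum_(u : T.-tuple U) joint_io G mu y u * F y u.

Definition E_belief T (f : Delta -> R) : R :=
  E_io (fun (y : T.+1.-tuple Y) u => f (history_belief G y u)).

(** A trajectory of horizon [T] stops before U_T, so this control is averaged explicitly with the
    control law. *)
Definition E_belief_control T (q : Delta -> U -> R) : R :=
  E_io (fun (y : T.+1.-tuple Y) (u : T.-tuple U) =>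
    \sum_u' mu y u u' * q (history_belief G y u) u').

(** The conditional entropy of U_T given the information state (Y^T, U^(T-1)). *)
Definition control_entropy T : R :=
  E_io (fun (y : T.+1.-tuple Y) (u : T.-tuple U) =>
    - \sum_u' mu y u u' * log2 (mu y u u')).

Definition step_prob (x : X) (u : U) (x' : X) (y' : Y) : R :=
  trans G u x' x * obs G u x' y'.

Lemma step_prob_pmf x u : \sum_x' \sum_y' step_prob x u x' y' = 1.
Proof.
rewrite -[RHS](trans_pmf G u x).2; apply: eq_bigr => x' _.
by rewrite -mulr_sumr (obs_pmf G u x').2 mulr1.
Qed.

Lemma step_prob_ge0 x u x' y' : 0 <= step_prob x u x' y'.
Proof. by rewrite mulr_ge0 ?(pmf_ge0 (trans_pmf _ _ _)) ?(pmf_ge0 (obs_pmf _ _ _)). Qed.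

Lemma joint0 (x : 1.-tuple X) (y : 1.-tuple Y) (u : 0.-tuple U) :
  joint G mu x y u =
  val (rho G) (tnth x ord0) * obs0 G (tnth x ord0) (tnth y ord0).
Proof. by rewrite /joint big_ord0 mulr1. Qed.

(** By causality factor [k] reads only the prefixes [take k.+1 y] and [take k u], so one more step
    leaves the earlier factors unchanged. *)
Lemma joint_rcons T (x : T.+1.-tuple X) (y : T.+1.-tuple Y) (u : T.-tuple U)
    x' y' u' :
  joint G mu (rcons_tuple x x') (rcons_tuple y y') (rcons_tuple u u') =
  joint G mu x y u * (mu y u u' * step_prob (last_state x) u' x' y').
Proof.
rewrite /joint big_ord_recr /= -!mulrA.
rewrite !(@tnth_rcons _ _ _ _ ord0 ord0) //; congr (_ * (_ * _)).
congr (_ * _).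
  apply: eq_bigr => k _.
  rewrite (@tnth_rcons _ _ u u' _ k) //.
  rewrite !(@tnth_rcons _ _ _ _ (lift ord0 (widen_ord _ k)) (lift ord0 k)) //.
  rewrite (@tnth_rcons _ _ _ _ _ (widen_ord (leqnSn _) k)) //.
  have kT := ltn_ord k.
  by rewrite (take_rcons y _ (leqW kT)) (take_rcons u _ (ltnW kT)).
rewrite (@tnth_rcons _ _ _ _ (widen_ord _ ord_max) ord_max) //.
rewrite !tnth_rcons_max //.
rewrite (take_rcons y) // (take_rcons u) // !take_oversize ?size_tuple //.
by rewrite /step_prob mulrCA.
Qed.

Lemma joint_ge0 T (x : T.+1.-tuple X) (y : T.+1.-tuple Y) (u : T.-tuple U) :
  0 <= joint G mu x y u.
Proof.
elim: T x y u => [|T IHT] x y u.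
  by rewrite joint0 mulr_ge0 ?(pmf_ge0 (belief_pmf _)) ?(pmf_ge0 (obs0_pmf _ _)).
have [x1 [x' ->]] := tuple_rcons_eq x; have [y1 [y' ->]] := tuple_rcons_eq y.
have [u1 [u' ->]] := tuple_rcons_eq u.
rewrite joint_rcons mulr_ge0 ?IHT // mulr_ge0 ?step_prob_ge0 //.
exact: pmf_ge0 (mu_policy _ _) _.
Qed.

Lemma joint_io_ge0 T (y : T.+1.-tuple Y) (u : T.-tuple U) : 0 <= joint_io G mu y u.
Proof. by apply: sumr_ge0 => x _; exact: joint_ge0. Qed.

Lemma E_mu_rcons T (f : T.+2.-tuple X -> T.+2.-tuple Y -> T.+1.-tuple U -> R) :
  E_mu G mu f =
  E_mu G mu (fun (x : T.+1.-tuple X) (y : T.+1.-tuple Y) (u : T.-tuple U) =>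
    \sum_u' mu y u u' * \sum_x' \sum_y' step_prob (last_state x) u' x' y' *
      f (rcons_tuple x x') (rcons_tuple y y') (rcons_tuple u u')).
Proof.
rewrite /E_mu sum_tuple_rcons; apply: eq_bigr => x _.
under eq_bigr => x' _ do rewrite sum_tuple_rcons.
rewrite exchange_big /=; apply: eq_bigr => y _.
under eq_bigr => x' _.
  under eq_bigr => y' _ do rewrite sum_tuple_rcons.
  rewrite exchange_big /=.
  over.
rewrite exchange_big /=; apply: eq_bigr => u _.
rewrite mulr_sumr.
under eq_bigr => x' _ do rewrite exchange_big /=.
rewrite exchange_big /=; apply: eq_bigr => u' _.
rewrite !mulr_sumr; apply: eq_bigr => x' _.
rewrite !mulr_sumr; apply: eq_bigr => y' _.
by rewrite joint_rcons !mulrA.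
Qed.

(** The integrands are compared only after weighting: trajectories of probability zero, where the
    logarithm of a product need not split, are thereby ignored. *)
Lemma eq_E_mu T (f g : T.+1.-tuple X -> T.+1.-tuple Y -> T.-tuple U -> R) :
  (forall x y u, joint G mu x y u * f x y u = joint G mu x y u * g x y u) ->
  E_mu G mu f = E_mu G mu g.
Proof. by move=> fg; do 3 (apply: eq_bigr => ? _). Qed.

Lemma E_muD T (f g : T.+1.-tuple X -> T.+1.-tuple Y -> T.-tuple U -> R) :
  E_mu G mu (fun x y u => f x y u + g x y u) = E_mu G mu f + E_mu G mu g.
Proof.
rewrite -big_split /=; apply: eq_bigr => x _; rewrite -big_split /=.
apply: eq_bigr => y _; rewrite -big_split /=; apply: eq_bigr => u _.
by rewrite mulrDr.
Qed.

Lemma sum_joint_rcons T (y : T.+1.-tuple Y) (u : T.-tuple U) y' u' (h : X -> R) :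
  \sum_(x : T.+2.-tuple X)
    joint G mu x (rcons_tuple y y') (rcons_tuple u u') * h (last_state x) =
  mu y u u' * \sum_(x : T.+1.-tuple X) joint G mu x y u *
    \sum_x' step_prob (last_state x) u' x' y' * h x'.
Proof.
rewrite sum_tuple_rcons mulr_sumr; apply: eq_bigr => x _.
rewrite !mulr_sumr; apply: eq_bigr => x' _.
by rewrite joint_rcons tnth_rcons_max //; ring.
Qed.

(** Bayes' rule without division: predict with the transition kernel, weight by the observation, and
    read off the normalizing constant [obs_prob]. *)
Lemma step_prob_belief (p : Delta) u' y' (h : X -> R) :
  belief_mean p (fun x => \sum_x' step_prob x u' x' y' * h x') =
  obs_prob G p u' y' * belief_mean (bayes_filter G p u' y') h.
Proof.
rewrite /belief_mean mulr_sumr.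
under [RHS]eq_bigr => x _ do rewrite mulrA bayes_filterE mulr_sumr mulr_suml.
rewrite [RHS]exchange_big /=; apply: eq_bigr => x _; rewrite mulr_sumr.
by apply: eq_bigr => x' _; rewrite /step_prob; ring.
Qed.

Lemma belief_mean1 (p : Delta) : belief_mean p (fun=> 1) = 1.
Proof. exact: (pmf_sum_const (belief_pmf p)). Qed.

(* The Bayesian filter computes the conditional law of the current state. *)
Lemma sum_joint_last T (y : T.+1.-tuple Y) (u : T.-tuple U) (h : X -> R) :
  \sum_(x : T.+1.-tuple X) joint G mu x y u * h (last_state x) =
  joint_io G mu y u * belief_mean (history_belief G y u) h.
Proof.
have ioE n (y1 : n.+1.-tuple Y) (u1 : n.-tuple U) : joint_io G mu y1 u1 =
    \sum_(x : n.+1.-tuple X) joint G mu x y1 u1 * (fun=> 1) (last_state x).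
  by apply: eq_bigr => x _; rewrite mulr1.
elim: T y u h => [|T IHT] y u h.
  have yE : y = [tuple tnth y ord0].
    by apply: eq_from_tnth => i; rewrite ord1.
  rewrite (tuple0 u) yE; move: (tnth y ord0) => y0.
  have aux h' : \sum_(x : 1.-tuple X) joint G mu x [tuple y0] [tuple] *
      h' (last_state x) = y0_prob G y0 * belief_mean (init_belief G y0) h'.
    rewrite sum_tuple1 /belief_mean mulr_sumr; apply: eq_bigr => x _.
    rewrite joint0 mulrA init_beliefE (mulrC (obs0 _ _ _)).
    by congr (_ * h' _).
  by rewrite ioE (aux h) (aux (fun=> 1)) belief_mean1 mulr1.
have [y1 [y' ->]] := tuple_rcons_eq y; have [u1 [u' ->]] := tuple_rcons_eq u.
rewrite ioE (sum_joint_rcons y1 u1 y' u' h) (sum_joint_rcons y1 u1 y' u' (fun=> 1)).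
rewrite (IHT _ _ (fun x => \sum_x' step_prob x u' x' y' * h x')).
rewrite (IHT _ _ (fun x => \sum_x' step_prob x u' x' y' * 1)).
rewrite !step_prob_belief belief_mean1 /= history_belief_rcons.
by rewrite mulr1 !mulrA.
Qed.

(** The belief is a sufficient statistic: the next observation depends on the past only through it
    and the control. This follows from the filter identity with the constant test function 1. *)
Lemma joint_io_rcons T (y : T.+1.-tuple Y) (u : T.-tuple U) y' u' :
  joint_io G mu (rcons_tuple y y') (rcons_tuple u u') =
  joint_io G mu y u *
    (mu y u u' * obs_prob G (history_belief G y u) u' y').
Proof.
have := sum_joint_rcons y u y' u' (fun=> 1).
under eq_bigr do rewrite mulr1.
rewrite -/(joint_io G mu _ _) => ->.
rewrite (sum_joint_last _ _ (fun x => \sum_x' step_prob x u' x' y' * 1)).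
by rewrite step_prob_belief belief_mean1 mulr1 mulrCA.
Qed.

Lemma joint_io0 (y : Y) : joint_io G mu [tuple y] [tuple] = y0_prob G y.
Proof.
rewrite /joint_io sum_tuple1; apply: eq_bigr => x _.
by rewrite joint0 mulrC.
Qed.

Lemma E_mu_last T (h : X -> T.+1.-tuple Y -> T.-tuple U -> R) :
  E_mu G mu (fun x y u => h (last_state x) y u) =
  E_io (fun y u => belief_mean (history_belief G y u) (fun x => h x y u)).
Proof.
rewrite /E_mu exchange_big /=; apply: eq_bigr => y _.
rewrite exchange_big /=; apply: eq_bigr => u _.
exact: (sum_joint_last y u (fun x => h x y u)).
Qed.

Lemma E_io0 (F : 1.-tuple Y -> 0.-tuple U -> R) :
  E_io F = \sum_y y0_prob G y * F [tuple y] [tuple].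
Proof.
rewrite /E_io sum_tuple1; apply: eq_bigr => y _.
by rewrite sum_tuple0 joint_io0.
Qed.

Lemma E_io_rcons T (F : T.+2.-tuple Y -> T.+1.-tuple U -> R) :
  E_io F = E_io (fun (y : T.+1.-tuple Y) (u : T.-tuple U) =>
    \sum_u' mu y u u' * \sum_y' obs_prob G (history_belief G y u) u' y' *
      F (rcons_tuple y y') (rcons_tuple u u')).
Proof.
rewrite /E_io sum_tuple_rcons; apply: eq_bigr => y _.
under eq_bigr => y' _ do rewrite sum_tuple_rcons.
rewrite exchange_big /=; apply: eq_bigr => u _.
rewrite exchange_big /= mulr_sumr; apply: eq_bigr => u' _.
rewrite !mulr_sumr; apply: eq_bigr => y' _.
by rewrite joint_io_rcons !mulrA.
Qed.

Lemma E_ioD T (F F' : T.+1.-tuple Y -> T.-tuple U -> R) :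
  E_io (fun y u => F y u + F' y u) = E_io F + E_io F'.
Proof.
rewrite -big_split /=; apply: eq_bigr => y _; rewrite -big_split /=.
by apply: eq_bigr => u _; rewrite mulrDr.
Qed.

Lemma E_ioZ T a (F : T.+1.-tuple Y -> T.-tuple U -> R) :
  E_io (fun y u => a * F y u) = a * E_io F.
Proof.
rewrite mulr_sumr; apply: eq_bigr => y _; rewrite mulr_sumr.
by apply: eq_bigr => u _; rewrite mulrCA.
Qed.

Lemma eq_E_io T (F F' : T.+1.-tuple Y -> T.-tuple U -> R) :
  (forall y u, F y u = F' y u) -> E_io F = E_io F'.
Proof. by move=> FF'; do 2 (apply: eq_bigr => ? _); rewrite FF'. Qed.

Lemma le_E_io T (F F' : T.+1.-tuple Y -> T.-tuple U -> R) :
  (forall y u, F y u <= F' y u) -> E_io F <= E_io F'.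
Proof.
by move=> FF'; do 2 (apply: ler_sum => ? _); rewrite ler_wpM2l ?joint_io_ge0.
Qed.

Lemma E_io_cst T c : E_io (fun (_ : T.+1.-tuple Y) (_ : T.-tuple U) => c) = c.
Proof.
elim: T => [|T IHT]; first by rewrite E_io0 (pmf_sum_const (y0_prob_pmf G)).
rewrite E_io_rcons -[RHS]IHT; apply: eq_E_io => y u.
under eq_bigr do rewrite (pmf_sum_const (obs_prob_pmf _ _ _)).
exact: (pmf_sum_const (mu_policy _ _)).
Qed.

Lemma E_io_le T (F : T.+1.-tuple Y -> T.-tuple U -> R) C :
  (forall y u, `|F y u| <= C) -> `|E_io F| <= C.
Proof.
move=> FC; rewrite ler_norml -{1}(E_io_cst T C) -{2}(E_io_cst T C) -mulN1r -E_ioZ.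
apply/andP; split; apply: le_E_io => y u.
  by rewrite mulN1r; case/ler_normlP: (FC y u); rewrite lerNl.
exact: ler_normlW.
Qed.

Lemma E_belief_le T f C : (forall p, `|f p| <= C) -> `|E_belief T f| <= C.
Proof. by move=> fC; exact: E_io_le. Qed.

Lemma E_belief_control_le T q C : (forall p u, `|q p u| <= C) ->
  `|E_belief_control T q| <= C.
Proof. by move=> qC; apply: E_io_le => y u; exact: (pmf_mean_le (mu_policy _ _)). Qed.

Lemma le_E_belief_control T q q' : (forall p u, q p u <= q' p u) ->
  E_belief_control T q <= E_belief_control T q'.
Proof.
move=> qq'; apply: le_E_io => y u; apply: ler_sum => u' _.
by rewrite ler_wpM2l ?(pmf_ge0 (mu_policy _ _)).
Qed.

Lemma E_belief_controlD T q q' :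
  E_belief_control T (fun p u => q p u + q' p u) =
  E_belief_control T q + E_belief_control T q'.
Proof.
rewrite -E_ioD; apply: eq_E_io => y u; rewrite -big_split /=.
by apply: eq_bigr => u' _; rewrite mulrDr.
Qed.

Lemma E_belief_controlZ T a q :
  E_belief_control T (fun p u => a * q p u) = a * E_belief_control T q.
Proof.
rewrite -E_ioZ; apply: eq_E_io => y u; rewrite mulr_sumr.
by apply: eq_bigr => u' _; rewrite mulrCA.
Qed.

Lemma eq_E_belief_control T q q' : (forall p u, q p u = q' p u) ->
  E_belief_control T q = E_belief_control T q'.
Proof.
by move=> qq'; apply: eq_E_io => y u; apply: eq_bigr => u' _; rewrite qq'.
Qed.

Lemma E_belief_control_belief T f :
  E_belief_control T (fun p _ => f p) = E_belief T f.
Proof. by apply: eq_E_io => y u; exact: (pmf_sum_const (mu_policy _ _)). Qed.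

Lemma E_belief0 f : E_belief 0 f = \sum_y y0_prob G y * f (init_belief G y).
Proof. exact: E_io0. Qed.

Lemma E_beliefS T f : E_belief T.+1 f = E_belief_control T (fun p u =>
  \sum_y obs_prob G p u y * f (bayes_filter G p u y)).
Proof.
rewrite /E_belief E_io_rcons; apply: eq_E_io => y u.
apply: eq_bigr => u' _; congr (_ * _); apply: eq_bigr => y' _.
by rewrite /= history_belief_rcons.
Qed.

End Policy.

(** * The regularized objective as a discounted sum *)

Section Objective.
Context (R : realType) (Nx Nu Ny : nat) (G : pomdp R Nx Nu Ny).
Local Notation X := 'I_Nx.
Local Notation U := 'I_Nu.
Local Notation Y := 'I_Ny.

Definition running_cost (h : X -> U -> R) (p : belief R Nx) (u : U) : R :=
  belief_mean p (h ^~ u).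

Definition cost_bound (h : X -> U -> R) : R := \sum_x \sum_u `|h x u|.

Lemma belief_mean_le (p : belief R Nx) (h : X -> R) C :
  (forall x, `|h x| <= C) -> `|belief_mean p h| <= C.
Proof. exact: (pmf_mean_le (belief_pmf p)). Qed.

Lemma running_cost_le h p u : `|running_cost h p u| <= cost_bound h.
Proof.
apply: belief_mean_le => x; rewrite /cost_bound (bigD1 x) //= (bigD1 u) //=.
by rewrite -addrA lerDl addr_ge0 ?sumr_ge0 // => x' _; rewrite sumr_ge0.
Qed.

Section Policy.
Context (mu : control_law R Nu Ny) (mu_policy : is_policy mu).
Local Notation last_state x := (tnth x ord_max).

Lemma E_mu_io T (F : T.+1.-tuple Y -> T.-tuple U -> R) :
  E_mu G mu (fun _ y u => F y u) = E_io G mu F.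
Proof.
rewrite (E_mu_last G mu (fun _ y u => F y u)); apply: eq_E_io => y u.
exact: (pmf_sum_const (belief_pmf _)).
Qed.

Lemma E_mu_control T (h : X -> U -> R) :
  E_mu G mu (fun (x : T.+1.-tuple X) (y : T.+1.-tuple Y) (u : T.-tuple U) =>
    \sum_u' mu y u u' * h (last_state x) u') =
  E_belief_control G mu T (running_cost h).
Proof.
rewrite (E_mu_last G mu (fun x y u => \sum_u' mu y u u' * h x u')).
apply: eq_E_io => y u; rewrite /belief_mean.
under eq_bigr do rewrite mulr_sumr; rewrite exchange_big /=.
apply: eq_bigr => u' _; rewrite /running_cost /belief_mean mulr_sumr.
by apply: eq_bigr => x _; rewrite mulrCA.
Qed.

Lemma running_cost_sum T (h : X -> U -> R) :
  E_mu G mu (fun (x : T.+1.-tuple X) _ (u : T.-tuple U) =>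
    \sum_(k < T) h (tnth x (widen_ord (leqnSn T) k)) (tnth u k)) =
  \sum_(0 <= k < T) E_belief_control G mu k (running_cost h).
Proof.
elim: T => [|T IHT].
  rewrite big_geq // -[RHS](E_io_cst G mu_policy 0 0) -E_mu_io.
  by apply: eq_E_mu => x y u; rewrite big_ord0.
rewrite big_nat_recr //= -IHT -E_mu_control -E_muD E_mu_rcons.
apply: eq_E_mu => x y u; congr (_ * _).
rewrite -[X in _ = X + _](pmf_sum_const (mu_policy y u)) -big_split /=.
apply: eq_bigr => u' _; rewrite -mulrDr; congr (_ * _).
rewrite -[RHS]mul1r -(step_prob_pmf G (last_state x) u') mulr_suml.
apply: eq_bigr => x' _; rewrite mulr_suml; apply: eq_bigr => y' _; congr (_ * _).
rewrite big_ord_recr /=; congr (_ + h _ _).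
- apply: eq_bigr => k _; rewrite (@tnth_rcons _ _ u u' _ k) //.
  by rewrite (@tnth_rcons _ _ x x' _ (widen_ord (leqnSn T) k)).
- by rewrite (@tnth_rcons _ _ x x' _ ord_max).
- by rewrite tnth_rcons_max.
Qed.

Definition joint_entropy T : R :=
  - E_mu G mu (fun (x : T.+1.-tuple X) y u => log2 (joint G mu x y u)).

(** Equal weights on the two entropies reduce to this sum. Where [joint] is positive, so is
    [joint_io], having it as one of its terms, and the logarithms of the quotient and its
    denominator add up. *)
Lemma entropy_chain T :
  smoother_entropy G mu T + io_entropy G mu T = joint_entropy T.
Proof.
rewrite /smoother_entropy /io_entropy -opprD -E_muD; congr (- _).
apply: eq_E_mu => x y u.
have [->|j0] := eqVneq (joint G mu x y u) 0; first by rewrite !mul0r.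
have jp : 0 < joint G mu x y u by rewrite lt0r j0 joint_ge0.
have iop : 0 < joint_io G mu y u.
  apply: (lt_le_trans jp); rewrite /joint_io (bigD1 x) //= lerDl.
  by apply: sumr_ge0 => x' _; exact: joint_ge0.
by rewrite -log2M ?divr_gt0 // divfK ?gt_eqF.
Qed.

Lemma joint_entropy0 : joint_entropy 0 = entropy_X0Y0 G.
Proof.
congr (- _); rewrite /E_mu sum_tuple1; apply: eq_bigr => x _.
rewrite sum_tuple1; apply: eq_bigr => y _.
by rewrite sum_tuple0 joint0.
Qed.

(** The logarithm splits for positive factors, and at [b = 0] or [c = 0] both sides vanish. It is
    used with a trajectory probability, a control probability and a step probability. *)
Let mul_log2_mul (a b c : R) : 0 < a -> 0 <= b -> 0 <= c ->
  b * (c * log2 (a * (b * c))) =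
  b * log2 a * c + b * (c * log2 c) + b * log2 b * c.
Proof.
move=> a0; rewrite le_eqVlt => /predU1P[<-|b0]; first by rewrite !mul0r !addr0.
rewrite le_eqVlt => /predU1P[<-|c0]; first by rewrite !(mul0r, mulr0) !addr0.
by rewrite !log2M ?mulr_gt0 //; ring.
Qed.

Lemma joint_entropyS T : joint_entropy T.+1 = joint_entropy T +
  (E_belief_control G mu T (running_cost (ctilde G)) + control_entropy G mu T).
Proof.
have oppE (f : T.+1.-tuple X -> T.+1.-tuple Y -> T.-tuple U -> R) :
    - E_mu G mu f = E_mu G mu (fun x y u => - f x y u).
  rewrite -sumrN; apply: eq_bigr => x _; rewrite -sumrN; apply: eq_bigr => y _.
  by rewrite -sumrN; apply: eq_bigr => u _; rewrite mulrN.
have sumZ a (F : X -> Y -> R) :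
    \sum_x' \sum_y' a * F x' y' = a * \sum_x' \sum_y' F x' y'.
  by rewrite mulr_sumr; apply: eq_bigr => x' _; rewrite mulr_sumr.
rewrite -E_mu_control /control_entropy -E_mu_io /joint_entropy E_mu_rcons.
rewrite !oppE -!E_muD; apply: eq_E_mu => x y u.
have [->|j0] := eqVneq (joint G mu x y u) 0; first by rewrite !mul0r.
have jp : 0 < joint G mu x y u by rewrite lt0r j0 joint_ge0.
(* Averaging the constant over the next control lets all terms be compared control by control. *)
congr (_ * _); rewrite -[log2 (joint G mu x y u)](pmf_sum_const (mu_policy y u)).
rewrite -!sumrN -!big_split /=; apply: eq_bigr => u' _.
rewrite /ctilde mulrN -!opprD; congr (- _).
transitivity (\sum_x' \sum_y' (
  mu y u u' * log2 (joint G mu x y u) * step_prob G (last_state x) u' x' y' +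
  mu y u u' * (step_prob G (last_state x) u' x' y' *
               log2 (step_prob G (last_state x) u' x' y')) +
  mu y u u' * log2 (mu y u u') * step_prob G (last_state x) u' x' y')).
  rewrite mulr_sumr; apply: eq_bigr => x' _; rewrite mulr_sumr.
  apply: eq_bigr => y' _; rewrite joint_rcons mul_log2_mul ?step_prob_ge0 //.
  exact: pmf_ge0 (mu_policy _ _) _.
under eq_bigr do rewrite 2!big_split /=.
(* The first and third terms are multiples of [step_prob], which sums to 1; the middle one is
   [ctilde] up to sign. *)
by rewrite 2!big_split /= !sumZ step_prob_pmf !mulr1 addrA.
Qed.

Lemma joint_entropyE T : joint_entropy T = entropy_X0Y0 G +
  \sum_(0 <= k < T) (E_belief_control G mu k (running_cost (ctilde G)) +
                     control_entropy G mu k).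
Proof.
elim: T => [|T IHT]; first by rewrite big_geq // addr0 joint_entropy0.
by rewrite joint_entropyS IHT big_nat_recr //= -addrA.
Qed.

Lemma control_entropy_ge0 T : 0 <= control_entropy G mu T.
Proof.
rewrite -(E_io_cst G mu_policy T 0); apply: le_E_io => // y u.
rewrite oppr_ge0; apply: sumr_le0 => u' _; apply: mul_log2_le0.
  exact: pmf_ge0 (mu_policy _ _) _.
exact: pmf_le1 (mu_policy _ _) _.
Qed.

Lemma control_entropy_le T : `|control_entropy G mu T| <= Nu%:R * (ln 2)^-1.
Proof.
rewrite ger0_norm ?control_entropy_ge0 // -[leRHS](E_io_cst G mu_policy T).
apply: le_E_io => // y u; rewrite -sumrN.
have -> : Nu%:R * (ln 2)^-1 = \sum_(u' < Nu) (ln 2)^-1 :> R.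
  by rewrite sumr_const card_ord mulr_natl.
apply: ler_sum => u' _; apply: neg_mul_log2_le.
exact: pmf_ge0 (mu_policy _ _) _.
Qed.

Context (g b : R) (g_gt0 : 0 < g) (g_lt1 : g < 1).
Context (c : X -> U -> R) (cT : X -> R).

Let a k := E_belief_control G mu k (running_cost c) +
  b * (E_belief_control G mu k (running_cost (ctilde G)) + control_entropy G mu k).
Let d k := E_belief G mu k (fun p => belief_mean p cT).

Lemma regularized_costE T : regularized_cost G b b c cT mu T =
  b * entropy_X0Y0 G + \sum_(0 <= k < T) a k + d T.
Proof.
rewrite /regularized_cost -addrA -mulrDr entropy_chain joint_entropyE.
rewrite /cost_J E_muD running_cost_sum.
rewrite (E_mu_last G mu (fun x _ _ => cT x)) [E_io _ _ _](_ : _ = d T) //.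
rewrite [\sum_(_ <= _ < _) a _]big_split /= -mulr_sumr.
by ring.
Qed.

Let regularized_cost_fun : regularized_cost G b b c cT mu =
  (fun T => b * entropy_X0Y0 G + \sum_(0 <= k < T) a k + d T).
Proof. by apply/funext => T; exact: regularized_costE. Qed.

Let aC k : `|a k| <= cost_bound c +
  `|b| * (cost_bound (ctilde G) + Nu%:R * (ln 2)^-1).
Proof.
apply: (le_trans (ler_normD _ _)); apply: lerD.
  by apply: E_belief_control_le => // p u; exact: running_cost_le.
rewrite normrM ler_wpM2l //; apply: (le_trans (ler_normD _ _)); apply: lerD.
  by apply: E_belief_control_le => // p u; exact: running_cost_le.
exact: control_entropy_le.
Qed.

Let dC k : `|d k| <= \sum_x `|cT x|.
Proof.
apply: E_belief_le => // p; apply: belief_mean_le => x.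
by rewrite (bigD1 x) //= lerDl sumr_ge0.
Qed.

Lemma regularized_normed_cvg :
  cvgn [normed series (fun t => horizon_pmf g t * regularized_cost G b b c cT mu t)].
Proof.
rewrite regularized_cost_fun.
exact: (horizon_normed_cvg g_gt0 g_lt1 aC dC).
Qed.

Lemma belief_costE p u : belief_cost G g b c cT p u =
  (1 - g) * belief_mean p cT +
  g * (running_cost c p u + b * running_cost (ctilde G) p u).
Proof.
rewrite /belief_cost /running_cost /belief_mean !mulr_sumr -big_split /=.
rewrite mulr_sumr -big_split /=; apply: eq_bigr => x _.
by rewrite /stage_cost; ring.
Qed.

Definition stage_term k : R :=
  E_belief_control G mu k (belief_cost G g b c cT) + g * b * control_entropy G mu k.

(** Given T >= k, the horizon ends at k with probability [1 - g], incurring the terminal cost, and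
    continues with probability [g], incurring the running cost. [stage_cost] has exactly these
    weights. *)
Lemma stage_termE k : (1 - g) * d k + g * a k = stage_term k.
Proof.
rewrite /stage_term (eq_E_belief_control _ _ _ belief_costE).
rewrite E_belief_controlD !E_belief_controlZ E_belief_controlD E_belief_controlZ.
by rewrite E_belief_control_belief // -/(d k) /a; ring.
Qed.

Lemma stage_term_le k : `|stage_term k| <= cost_bound (stage_cost G g b c cT) +
  `|g * b| * (Nu%:R * (ln 2)^-1).
Proof.
apply: (le_trans (ler_normD _ _)); apply: lerD.
  by apply: E_belief_control_le => // p u; exact: running_cost_le.
by rewrite normrM ler_wpM2l // control_entropy_le.
Qed.

Lemma regularized_expectation :
  E_T g (regularized_cost G b b c cT mu) =
  b * entropy_X0Y0 G + limn (series (fun k => g ^+ k * stage_term k)).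
Proof.
rewrite regularized_cost_fun (horizon_expectation g_gt0 g_lt1 _ aC dC).
by under eq_fun do rewrite stage_termE.
Qed.

End Policy.
End Objective.

(** * Dynamic programming on beliefs *)

Section Bellman.
Context (R : realType) (Nx Nu Ny : nat) (G : pomdp R Nx Nu Ny).
Context (g : R) (g_gt0 : 0 < g) (g_lt1 : g < 1).
Local Notation Delta := (belief R Nx).
Local Notation U := 'I_Nu.
Context (L : Delta -> U -> R) (C : R) (L_le : forall p u, `|L p u| <= C).

Definition expected_next (V : Delta -> R) (p : Delta) (u : U) : R :=
  \sum_y obs_prob G p u y * V (bayes_filter G p u y).

Definition qvalue (V : Delta -> R) (p : Delta) (u : U) : R :=
  L p u + g * expected_next V p u.

Lemma expected_next_le V B p u : (forall p, `|V p| <= B) ->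
  `|expected_next V p u| <= B.
Proof. by move=> VB; apply: pmf_mean_le => //; exact: obs_prob_pmf. Qed.

Lemma qvalueB V W p u :
  qvalue V p u - qvalue W p u = g * expected_next (fun p => V p - W p) p u.
Proof.
rewrite /qvalue opprD addrACA subrr add0r -mulrBr -sumrB; congr (_ * _).
by apply: eq_bigr => y _; rewrite mulrBr.
Qed.

Lemma qvalue_contraction V W e p u : (forall p, `|V p - W p| <= e) ->
  `|qvalue V p u - qvalue W p u| <= g * e.
Proof.
move=> VW; rewrite qvalueB normrM (gtr0_norm g_gt0) ler_pM2l //.
exact: expected_next_le.
Qed.

Lemma qvalue0 p u : qvalue (fun=> 0) p u = L p u.
Proof. by rewrite /qvalue /expected_next big1 ?mulr0 ?addr0 // => y _; rewrite mulr0. Qed.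

Lemma policy_value_exists (b : Delta -> U) :
  exists2 W : Delta -> R, (forall p, `|W p| <= C / (1 - g)) &
    forall p, W p = qvalue W p (b p).
Proof.
apply: (@contraction_fixpoint _ _ g_gt0 g_lt1 _ (fun V p => qvalue V p (b p))).
  by move=> p; rewrite qvalue0.
by move=> V W e VW p; exact: qvalue_contraction.
Qed.

(** With finitely many controls the minimum is attained at every belief, so a greedy policy exists
    by choice of a minimizer; [u0] supplies a first candidate. *)
Lemma optimal_value_exists (u0 : U) :
  exists V : Delta -> R, exists b : Delta -> U,
  [/\ forall p, `|V p| <= C / (1 - g), forall p, V p = qvalue V p (b p) &
      forall p u, V p <= qvalue V p u].
Proof.
pose greedy V p := [arg min_(u < u0) qvalue V p u]%O.
have greedyP V p u : qvalue V p (greedy V p) <= qvalue V p u.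
  by rewrite /greedy; case: arg_minP => // u' _; apply.
have [V VC VE] : exists2 V : Delta -> R, (forall p, `|V p| <= C / (1 - g)) &
    forall p, V p = qvalue V p (greedy V p).
  apply: (@contraction_fixpoint _ _ g_gt0 g_lt1 _ (fun V p => qvalue V p (greedy V p))).
    by move=> p; rewrite qvalue0.
  (* The minimum is nonexpansive: each minimal value is compared with the value at the greedy
     control of the other function. *)
  move=> V W e VW p; rewrite ler_distl; apply/andP; split.
    rewrite lerBlDr; apply: (le_trans (greedyP W p (greedy V p))).
    rewrite -lerBlDl; apply: le_trans (ler_norm _) _.
    by rewrite distrC; exact: qvalue_contraction.
  apply: (le_trans (greedyP V p (greedy W p))).
  rewrite -lerBlDl; apply: le_trans (ler_norm _) _.
  exact: qvalue_contraction.
exists V, (greedy V); split=> // p u.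
by rewrite VE.
Qed.

(** The excess [V - W] is at most [g] times its mean over the successor beliefs, so the initial
    bound [2 * B] gains a factor [g] at each iteration. *)
Lemma policy_value_comparison (b : Delta -> U) V W B :
  (forall p, `|V p| <= B) -> (forall p, `|W p| <= B) ->
  (forall p, V p <= qvalue V p (b p)) -> (forall p, W p = qvalue W p (b p)) ->
  forall p, V p <= W p.
Proof.
move=> VB WB Vle WE p; rewrite -subr_le0.
apply: (@le_geometric_le0 _ g g_gt0 g_lt1 _ (2 * B)) => n; elim: n p => [|n IHn] p.
  rewrite expr0 mulr1; apply: le_trans (ler_norm _) _.
  by apply: (le_trans (ler_normB _ _)); rewrite mulr_natl mulr2n lerD.
rewrite [W p]WE; apply: (@le_trans _ _ (qvalue V p (b p) - qvalue W p (b p))).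
  by rewrite lerD2r.
rewrite qvalueB exprS mulrCA ler_pM2l //.
rewrite -[leRHS](pmf_sum_const (obs_prob_pmf G p (b p))).
apply: ler_sum => y _; rewrite ler_wpM2l ?IHn //.
exact: pmf_ge0 (obs_prob_pmf _ _ _) _.
Qed.
End Bellman.

(** * Verification: the value function bounds the objective from below, and stationary policies are
    evaluated exactly *)

Section Verification.
Context (R : realType) (Nx Nu Ny : nat) (G : pomdp R Nx Nu Ny).
Context (g beta : R) (g_gt0 : 0 < g) (g_lt1 : g < 1) (beta_ge0 : 0 <= beta).
Context (c : 'I_Nx -> 'I_Nu -> R) (cT : 'I_Nx -> R).
Local Notation Delta := (belief R Nx).
Local Notation U := 'I_Nu.
Local Notation L := (belief_cost G g beta c cT).
Local Notation objective mu := (E_T g (regularized_cost G beta beta c cT mu)).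

Lemma belief_cost_le p u :
  `|L p u| <= cost_bound (stage_cost G g beta c cT).
Proof. exact: running_cost_le. Qed.

Lemma objective_ge mu V B : is_policy mu -> (forall p, `|V p| <= B) ->
  (forall p u, V p <= qvalue G g L V p u) ->
  beta * entropy_X0Y0 G + \sum_y y0_prob G y * V (init_belief G y) <= objective mu.
Proof.
move=> mu_policy VB Vle; rewrite regularized_expectation // lerD2l -(E_belief0 G mu).
apply: (@discounted_telescope_ge _ g g_gt0 g_lt1 _ (fun k => E_belief G mu k V) B).
- exact: (@stage_term_le _ _ _ _ G mu mu_policy g beta c cT).
- by move=> k; apply: E_belief_le.
(* The Bellman inequality holds for each control and so survives averaging over a randomized one.
   The control entropy only adds to the right-hand side, since [beta] is nonnegative. *)
move=> k; rewrite lerBlDr E_beliefS -E_belief_controlZ /stage_term addrAC.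
rewrite -E_belief_controlD -(E_belief_control_belief G mu_policy) ler_wpDr //.
  by rewrite mulr_ge0 ?mulr_ge0 ?(ltW g_gt0) ?control_entropy_ge0.
exact: le_E_belief_control.
Qed.

Lemma induced_policy_is_policy b : is_policy (induced_policy G b).
Proof.
move=> k y u; split=> [u'|]; first by rewrite /induced_policy ler0n.
by rewrite -(big_pred1_eq +%R (b (history_belief G y u)) (fun=> 1)) [RHS]big_mkcond;
  apply: eq_bigr => u' _; rewrite /induced_policy; case: eqP.
Qed.

Lemma induced_policy_mean b n (y : n.+1.-tuple 'I_Ny) (u : n.-tuple U) (f : U -> R) :
  \sum_u' induced_policy G b y u u' * f u' = f (b (history_belief G y u)).
Proof.
rewrite (bigD1 (b (history_belief G y u))) //= big1 ?addr0.
  by rewrite /induced_policy eqxx mul1r.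
by move=> u' /negPf u'b; rewrite /induced_policy u'b mul0r.
Qed.

Lemma E_induced_policy b k q :
  E_belief_control G (induced_policy G b) k q =
  E_belief G (induced_policy G b) k (fun p => q p (b p)).
Proof. by apply: eq_E_io => y u; exact: induced_policy_mean. Qed.

Lemma control_entropy_induced b k : control_entropy G (induced_policy G b) k = 0.
Proof.
rewrite -[RHS](E_io_cst G (induced_policy_is_policy b) k 0); apply: eq_E_io => y u.
by rewrite induced_policy_mean /induced_policy eqxx /log2 ln1 mul0r oppr0.
Qed.

(** The inequality of [objective_ge] becomes an equality: the control is [b] of the belief, its
    entropy vanishes, and the fixed point equation telescopes exactly. *)
Lemma objective_induced b W B : (forall p, `|W p| <= B) ->
  (forall p, W p = qvalue G g L W p (b p)) ->
  objective (induced_policy G b) =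
  beta * entropy_X0Y0 G + \sum_y y0_prob G y * W (init_belief G y).
Proof.
move=> WB WE; have mu_policy := induced_policy_is_policy b.
rewrite regularized_expectation //; congr (_ + _).
rewrite -(E_belief0 G (induced_policy G b)).
apply/cvg_lim; first exact: Rhausdorff.
apply: (@discounted_telescope _ g g_gt0 g_lt1 _
  (fun k => E_belief G (induced_policy G b) k W) B).
  by move=> k; apply: E_belief_le.
move=> k; rewrite /stage_term control_entropy_induced mulr0 addr0.
apply/eqP; rewrite eq_sym subr_eq E_beliefS -E_belief_controlZ -E_belief_controlD.
rewrite E_induced_policy; apply/eqP; apply: eq_E_io => y u; exact: WE.
Qed.
End Verification.

(** * Belief models *)

Section Model.
Context (R : realType) (Nx Nu Ny : nat) (G : pomdp R Nx Nu Ny).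
Context (b : belief R Nx -> 'I_Nu) (p0 : belief R Nx) (m : belief_model G b p0).
Local Notation Delta := (belief R Nx).
Local Notation Y := 'I_Ny.
Local Notation P := (bm_prob m).
Local Notation T := (bm_space m).

Definition obs_history n (w : T) : n.-tuple Y := [tuple bm_Y m i w | i < n].

(** For each [n] these cells form a finite measurable partition on whose pieces pi_n is constant, so
    expectations of functions of pi_n become finite sums. *)
Definition obs_cell n (s : n.-tuple Y) : set T := [set w | obs_history n w = s].

Definition obs_belief (s : seq Y) : Delta :=
  foldl (fun p y => bayes_filter G p (b p) y) p0 s.

Lemma obs_historyS n w :
  obs_history n.+1 w = rcons_tuple (obs_history n w) (bm_Y m n w).
Proof.
apply: eq_from_tnth => i; rewrite tnth_mktuple.
have := ltn_ord i; rewrite ltnS leq_eqVlt => /predU1P[e|lt].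
  by rewrite tnth_rcons_max // e.
by rewrite (@tnth_rcons _ _ _ _ _ (Ordinal lt)) // tnth_mktuple.
Qed.

Lemma bm_piE n w : bm_pi m n w = obs_belief (obs_history n w).
Proof.
elim: n => [|n IHn]; first by rewrite bm_pi0 [obs_history 0 w]tuple0.
by rewrite obs_historyS bm_piS bm_UE IHn /obs_belief /= foldl_rcons.
Qed.

Lemma obs_cell0 : obs_cell [tuple] = setT.
Proof. by apply/seteqP; split=> // w _; exact: tuple0. Qed.

Lemma obs_cell_rcons n (s : n.-tuple Y) y :
  obs_cell (rcons_tuple s y) = obs_cell s `&` [set w | bm_Y m n w = y].
Proof.
apply/seteqP; split=> w; rewrite /obs_cell /= obs_historyS.
  by move=> /(congr1 val)/rcons_inj[e ->]; split=> //; exact: val_inj.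
by move=> [-> ->].
Qed.

Lemma measurable_obs_cell n (s : n.-tuple Y) : measurable (obs_cell s).
Proof.
elim: n s => [|n IHn] s; first by rewrite (tuple0 s) obs_cell0.
have [s' [y ->]] := tuple_rcons_eq s; rewrite obs_cell_rcons.
by apply: measurableI => //; exact: bm_Y_meas.
Qed.

Lemma prob_obs_cell_rcons n (s : n.-tuple Y) y :
  (P (obs_cell (rcons_tuple s y)) =
   P (obs_cell s) * (obs_prob G (obs_belief s) (b (obs_belief s)) y)%:E)%E.
Proof.
(* [bm_law] is stated along an outcome; if no outcome has the history [s], both sides are 0. *)
have [[w sw]|none] := pselect (exists w, obs_cell s w); last first.
  have s0 : obs_cell s = set0.
    by apply/seteqP; split=> // w sw; apply: none; exists w.
  by rewrite obs_cell_rcons s0 set0I measure0 mul0e.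
have past : [set w' | forall j, (j < n)%N -> bm_Y m j w' = bm_Y m j w] = obs_cell s.
  rewrite -sw; apply/seteqP; split=> w' /=.
    move=> h; apply: eq_from_tnth => i; rewrite !tnth_mktuple; exact: h.
  move=> h j jn; have := congr1 (fun t => tnth t (Ordinal jn)) h.
  by rewrite !tnth_mktuple.
have := @bm_law _ _ _ _ _ _ _ m n w y; rewrite /= past obs_cell_rcons bm_UE bm_piE.
by rewrite sw.
Qed.

Definition bm_mean n (f : Delta -> R) : R :=
  \sum_(s : n.-tuple Y) fine (P (obs_cell s)) * f (obs_belief s).

Lemma bm_mean0 f : bm_mean 0 f = f p0.
Proof. by rewrite /bm_mean sum_tuple0 obs_cell0 probability_setT mul1r. Qed.

Lemma bm_meanS n f :
  bm_mean n.+1 f = bm_mean n (fun p => expected_next G f p (b p)).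
Proof.
rewrite /bm_mean sum_tuple_rcons; apply: eq_bigr => s _.
rewrite mulr_sumr; apply: eq_bigr => y _.
have fin_cell : P (obs_cell s) \is a fin_num.
  exact: fin_num_measure (measurable_obs_cell s).
rewrite prob_obs_cell_rcons fineM // -mulrA.
by rewrite /obs_belief foldl_rcons.
Qed.

(** This displays [f] of pi_n as a simple function for an arbitrary [f], from which integrability
    follows. *)
Lemma bm_pi_indic n (f : Delta -> R) w :
  f (bm_pi m n w) =
  \sum_(s : n.-tuple Y) f (obs_belief s) * \1_(obs_cell s) w.
Proof.
rewrite (bigD1 (obs_history n w)) //= big1 ?addr0.
  by rewrite indicE mem_set // mulr1 bm_piE.
by move=> s sw; rewrite indicE memNset ?mulr0 // => e; move: sw; rewrite -e eqxx.
Qed.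

Let integrable_cell n (s : n.-tuple Y) a :
  P.-integrable setT (fun w => a%:E * (\1_(obs_cell s) w)%:E)%E.
Proof.
apply: integrableZl => //; apply: integrable_indic => //.
exact: measurable_obs_cell.
Qed.

Lemma bm_pi_integrable n (f : Delta -> R) :
  P.-integrable setT (fun w => (f (bm_pi m n w))%:E).
Proof.
under eq_fun do rewrite bm_pi_indic -sumEFin.
by apply: integrable_sum => // s _; under eq_fun do rewrite EFinM; exact: integrable_cell.
Qed.

Lemma bm_pi_integral n (f : Delta -> R) :
  (\int[P]_w (f (bm_pi m n w))%:E = (bm_mean n f)%:E)%E.
Proof.
under eq_integral => w _.
  rewrite bm_pi_indic -sumEFin; under eq_bigr do rewrite EFinM.
  over.
rewrite /= integral_sum //.
rewrite /bm_mean -sumEFin; apply: eq_bigr => s _.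
have mS := measurable_obs_cell s.
rewrite integralZl //; last exact: integrable_indic.
rewrite integral_indic // setIT mulrC EFinM fineK //.
exact: fin_num_measure.
Qed.

Lemma bm_mean_le n f C : (forall p, `|f p| <= C) -> `|bm_mean n f| <= C.
Proof.
elim: n f => [|n IHn] f fC; first by rewrite bm_mean0.
by rewrite bm_meanS; apply: IHn => p; exact: expected_next_le.
Qed.

Lemma bm_meanB n f h : bm_mean n (fun p => f p - h p) = bm_mean n f - bm_mean n h.
Proof. by rewrite /bm_mean -sumrB; apply: eq_bigr => s _; rewrite mulrBr. Qed.

Lemma bm_meanZ n a f : bm_mean n (fun p => a * f p) = a * bm_mean n f.
Proof. by rewrite /bm_mean mulr_sumr; apply: eq_bigr => s _; rewrite mulrCA. Qed.

Context (g beta : R) (g_gt0 : 0 < g) (g_lt1 : g < 1).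
Context (c : 'I_Nx -> 'I_Nu -> R) (cT : 'I_Nx -> R).
Local Notation L := (belief_cost G g beta c cT).
Let Lb p := L p (b p).
Let C := cost_bound (stage_cost G g beta c cT).

Let term w k := g ^+ k * Lb (bm_pi m k w).

Let termE w : (fun k => g ^+ k * L (bm_pi m k w) (bm_U m k w)) = term w.
Proof. by apply/funext => k; rewrite bm_UE. Qed.

Let LbC p : `|Lb p| <= C.
Proof. exact: belief_cost_le. Qed.

Lemma discounted_sum_cvg w :
  cvgn (series (fun k => g ^+ k * L (bm_pi m k w) (bm_U m k w))).
Proof. by rewrite termE; apply: (discounted_cvg g_gt0 g_lt1 (C := C)). Qed.

(** The partial sums are bounded by [C / (1 - g)], a constant integrable under a probability, so the
    expectation passes through the series. *)
Let dominated :
  P.-integrable setT (EFin \o discounted_sum g beta c cT m) /\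
  (\int[P]_w (series (term w) n)%:E)%E @[n --> \oo] -->
  (\int[P]_w (discounted_sum g beta c cT m w)%:E)%E.
Proof.
have part_int n : P.-integrable setT (fun w => (series (term w) n)%:E).
  rewrite /series /=; under eq_fun do rewrite -sumEFin.
  by apply: integrable_sum => // k _; exact: (bm_pi_integrable k (fun p => g ^+ k * Lb p)).
have mpart n : measurable_fun setT (fun w => series (term w) n).
  by apply/measurable_EFinP; exact: measurable_int (part_int n).
have conv w : series (term w) n @[n --> \oo] --> discounted_sum g beta c cT m w.
  by rewrite /discounted_sum termE; apply: (discounted_cvg g_gt0 g_lt1 (C := C)).
have [] := @dominated_convergence _ T R P setT measurableT
  (fun n w => (series (term w) n)%:E)
  (EFin \o discounted_sum g beta c cT m) (EFin \o cst (C / (1 - g))).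
- by move=> n; apply/measurable_EFinP.
- apply/measurable_EFinP; apply: (@measurable_fun_cvg _ _ _ setT (fun n w => series (term w) n)) => //.
- by apply: aeW => w _; apply: cvg_EFin; [exact: nearW|exact: conv].
- exact: finite_measure_integrable_cst.
- apply: aeW => w n _; rewrite lee_fin.
  exact: (discounted_sum_le g_gt0 g_lt1).
by move=> iS _ cS; split.
Qed.

Lemma discounted_sum_integrable :
  P.-integrable setT (EFin \o discounted_sum g beta c cT m).
Proof. exact: (proj1 dominated). Qed.

Lemma discounted_costE W B : (forall p, `|W p| <= B) ->
  (forall p, W p = qvalue G g L W p (b p)) ->
  discounted_cost g beta c cT m = (W p0)%:E.
Proof.
move=> WB WE; rewrite /discounted_cost unlock.
have [_ lim_int] := dominated.
have partE n : (\int[P]_w (series (term w) n)%:E)%E =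
    (series (fun k => g ^+ k * bm_mean k Lb) n)%:E.
  under eq_integral do rewrite /series /= -sumEFin.
  rewrite integral_sum //=; last first.
    by move=> k; exact: (bm_pi_integrable k (fun p => g ^+ k * Lb p)).
  rewrite -sumEFin; apply: eq_bigr => k _.
  by rewrite (bm_pi_integral k (fun p => g ^+ k * Lb p)) bm_meanZ.
(* The mean of the stage cost at time [k] is [bm_mean k W - g * bm_mean k.+1 W], so the series
   telescopes to the value at [p0]. *)
have lim_W : (series (fun k => g ^+ k * bm_mean k Lb) n)%:E @[n --> \oo] --> (W p0)%:E.
  apply: cvg_EFin; first exact: nearW.
  rewrite -[W p0](bm_mean0 W).
  apply: (discounted_telescope g_gt0 g_lt1 (v := fun k => bm_mean k W) (C := B)).
    by move=> k; exact: bm_mean_le.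
  move=> k; rewrite bm_meanS -bm_meanZ -bm_meanB; congr (bm_mean k _).
  by apply/funext => p; rewrite [in RHS]WE /qvalue addrK.
move: lim_int; under eq_fun do rewrite partE.
by move=> lim_int; apply: cvg_unique lim_int lim_W; exact: ereal_hausdorff.
Qed.
End Model.

(** * Equivalence of the two problems *)

Lemma ereal_inf_attained (R : realType) (S : set (\bar R)) (x : \bar R) :
  S x -> lbound S x -> ereal_inf S = x.
Proof.
move=> Sx lb; apply/eqP; rewrite eq_le ereal_inf_lbound //=.
exact: le_ereal_inf_tmp.
Qed.

Lemma sum_mule_EFin (R : realType) (I : finType) (a f : I -> R) :
  (\sum_i (a i)%:E * (f i)%:E)%E = (\sum_i a i * f i)%:E.
Proof. by rewrite -sumEFin; apply: eq_bigr => i _; rewrite EFinM. Qed.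

(** Serves the case without controls, where every infimum is [+oo]. Some weight is positive, and
    terms of weight 0 contribute 0. *)
Lemma pmf_sum_pinfty (R : realType) (I : finType) (p : I -> R) : is_pmf p ->
  (\sum_i (p i)%:E * +oo)%E = +oo%E :> \bar R.
Proof.
move=> p_pmf; have [[i pi]|p0] := pselect (exists i, 0 < p i); last first.
  have [p_ge0 /eqP] := p_pmf; rewrite big1 => [|i _].
    by rewrite eq_sym oner_eq0.
  apply/eqP; rewrite eq_le p_ge0 andbT leNgt; apply/negP => pi.
  by apply: p0; exists i.
rewrite (bigD1 i) //= gt0_muley ?lte_fin // addye // gt_eqF //.
apply: (@lt_le_trans _ _ 0%E) => //; apply: sume_ge0 => j _.
by rewrite mule_ge0 ?leey // lee_fin pmf_ge0.
Qed.

(** A weighted sum of the nonnegative gaps [h i - f i] vanishes only if each gap of positive weight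
    does. This characterizes optimal policies up to initial observations of probability zero. *)
Lemma eq_weighted_sum (R : realType) (I : finType) (p f h : I -> R) :
  (forall i, 0 <= p i) -> (forall i, f i <= h i) ->
  \sum_i p i * h i = \sum_i p i * f i <-> forall i, 0 < p i -> h i = f i.
Proof.
move=> p0 fh; split=> [e i pi|e].
  have /eqP : \sum_i p i * (h i - f i) = 0.
    by under eq_bigr do rewrite mulrBr; rewrite sumrB e subrr.
  rewrite psumr_eq0 => [/allP /(_ i)|j _]; last by rewrite mulr_ge0 ?subr_ge0.
  rewrite mem_index_enum => /(_ isT) /=.
  by rewrite mulf_eq0 gt_eqF //= subr_eq0 => /eqP.
apply: eq_bigr => i _; have := p0 i; rewrite le_eqVlt => /predU1P[<-|/e -> //].
by rewrite !mul0r.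
Qed.

Lemma is_policy_action (R : realType) (Nx Nu Ny : nat) (G : pomdp R Nx Nu Ny)
  (mu : control_law R Nu Ny) : is_policy mu -> inhabited 'I_Nu.
Proof.
move=> mu_policy; have [_ y1] := y0_prob_pmf G.
case: (pickP 'I_Ny) => [y _|noy]; last first.
  by move/eqP: y1; rewrite big_pred0 // eq_sym oner_eq0.
case: (pickP 'I_Nu) => [u _|nou]; first by constructor.
have [_ /eqP] := mu_policy 0 [tuple y] [tuple].
by rewrite big_pred0 // eq_sym oner_eq0.
Qed.

Theorem mainTheorem2 (R : realType) (Nx Nu Ny : nat) (G : pomdp R Nx Nu Ny)
  (c : 'I_Nx -> 'I_Nu -> R) (cT : 'I_Nx -> R) (gamma beta lambda : R)
  (gamma_gt0 : 0 < gamma) (gamma_lt1 : gamma < 1)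
  (beta_lambda : beta = lambda) (beta_ge0 : 0 <= beta)
  (M : forall (b : belief R Nx -> 'I_Nu) (p : belief R Nx), belief_model G b p) :
  let objective mu :=
    E_T gamma (regularized_cost G beta lambda c cT mu) in
  let belief_objective b p :=
    discounted_cost gamma beta c cT (M b p) in
  let primal_value :=
    ereal_inf [set (objective mu)%:E | mu in [set mu | is_policy mu]] in
  let belief_value p :=
    ereal_inf (range (fun b => belief_objective b p)) in
  let H0 := (beta * entropy_X0Y0 G)%:E in
  [/\ (* the expectations over the horizon and over the belief process exist *)
      (forall mu, is_policy mu ->
         cvgn [normed series (fun t =>
           horizon_pmf gamma t * regularized_cost G beta lambda c cT mu t)]) /\
      (forall b p,
         (forall w, cvgn (series (fun k =>
            gamma ^+ k * belief_cost G gamma beta c cT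
                           (bm_pi (M b p) k w) (bm_U (M b p) k w)))) /\
         (bm_prob (M b p)).-integrable setT
           (EFin \o discounted_sum gamma beta c cT (M b p))),
      (* optimal values, with the belief-state problem posed for each
         realization of pi_0 or with one policy for all realizations *)
      (primal_value =
         H0 + \sum_(y : 'I_Ny) (y0_prob G y)%:E * belief_value (init_belief G y))%E /\
      (primal_value =
         H0 + ereal_inf (range (fun b =>
           \sum_(y : 'I_Ny) (y0_prob G y)%:E *
                            belief_objective b (init_belief G y))))%E,
      (* objectives of corresponding policies *)
      (forall b, is_policy (induced_policy G b) /\
         (objective (induced_policy G b))%:E =
         (H0 + \sum_(y : 'I_Ny) (y0_prob G y)%:E *
                                belief_objective b (init_belief G y))%E)
    & (* optimal policies *)
      (forall b,
         (objective (induced_policy G b))%:E = primal_value <->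
         (forall y, 0 < y0_prob G y ->
            belief_objective b (init_belief G y) =
            belief_value (init_belief G y)))].
Proof.
subst lambda; move=> objective belief_objective primal_value belief_value H0.
pose L := belief_cost G gamma beta c cT.
pose B := cost_bound (stage_cost G gamma beta c cT) / (1 - gamma).
have LC p u : `|L p u| <= cost_bound (stage_cost G gamma beta c cT).
  exact: belief_cost_le.
have W_exists (b : belief R Nx -> 'I_Nu) : exists W : belief R Nx -> R,
    (forall p, `|W p| <= B) /\ (forall p, W p = qvalue G gamma L W p (b p)).
  by have [W WB WE] := policy_value_exists G gamma_gt0 gamma_lt1 LC b; exists W.
have [W WP] := choice W_exists.
have belief_objectiveE b p : belief_objective b p = (W b p)%:E.
  by have [WB WE] := WP b; exact: (discounted_costE (M b p) gamma_gt0 gamma_lt1 WB WE).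
have weighted_objectiveE b :
    (\sum_(y : 'I_Ny) (y0_prob G y)%:E * belief_objective b (init_belief G y))%E =
    (\sum_y y0_prob G y * W b (init_belief G y))%:E.
  by rewrite -sum_mule_EFin; apply: eq_bigr => y _; rewrite belief_objectiveE.
have objectiveE b : objective (induced_policy G b) =
    beta * entropy_X0Y0 G + \sum_y y0_prob G y * W b (init_belief G y).
  by have [WB WE] := WP b; exact: (objective_induced gamma_gt0 gamma_lt1 WB WE).
have existence : (forall mu, is_policy mu ->
         cvgn [normed series (fun t =>
           horizon_pmf gamma t * regularized_cost G beta beta c cT mu t)]) /\
      (forall b p,
         (forall w, cvgn (series (fun k =>
            gamma ^+ k * belief_cost G gamma beta c cT
                           (bm_pi (M b p) k w) (bm_U (M b p) k w)))) /\
         (bm_prob (M b p)).-integrable setT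
           (EFin \o discounted_sum gamma beta c cT (M b p))).
  split=> [mu mu_policy|b p].
    exact: regularized_normed_cvg.
  split=> [w|]; first exact: discounted_sum_cvg.
  exact: discounted_sum_integrable.
have induced b : is_policy (induced_policy G b) /\
    (objective (induced_policy G b))%:E =
    (H0 + \sum_(y : 'I_Ny) (y0_prob G y)%:E *
                           belief_objective b (init_belief G y))%E.
  by split; [exact: induced_policy_is_policy|rewrite weighted_objectiveE objectiveE].
(* Without controls neither problem has a policy, and all the infima are [+oo]. *)
case: (pselect (inhabited 'I_Nu)) => [[u0]|no_action]; last first.
  have no_policy (b : belief R Nx -> 'I_Nu) : False.
    by apply: no_action; constructor; exact: b (rho G).
  have inf_range (f : (belief R Nx -> 'I_Nu) -> \bar R) :
      ereal_inf (range f) = +oo%E.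
    rewrite (_ : range f = set0) ?ereal_inf0 //.
    by apply/seteqP; split=> // x [b]; case: (no_policy b).
  have primalE : primal_value = +oo%E.
    rewrite /primal_value (_ : [set _ | _ in _] = set0) ?ereal_inf0 //.
    apply/seteqP; split=> // x [mu mu_policy _].
    by apply: no_action; exact: (is_policy_action G mu_policy).
  split=> //.
  rewrite primalE inf_range addey //; split=> //.
  under eq_bigr do rewrite /belief_value inf_range.
  by rewrite (pmf_sum_pinfty (y0_prob_pmf G)) addey.
have [V [bopt [VB VE Vle]]] := optimal_value_exists G gamma_gt0 gamma_lt1 LC u0.
have VW b p : V p <= W b p.
  have [WB WE] := WP b.
  exact: (policy_value_comparison gamma_gt0 gamma_lt1 VB WB (fun p => Vle p (b p)) WE).
(* Both functions solve the fixed point equation of [bopt]; the comparison lemma gives the remaining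
   inequality. *)
have WboptE p : W bopt p = V p.
  have [WB WE] := WP bopt; apply/eqP; rewrite eq_le VW andbT.
  apply: (policy_value_comparison gamma_gt0 gamma_lt1 WB VB) => //.
  by move=> q; rewrite {1}WE.
have belief_valueE p : belief_value p = (V p)%:E.
  apply: ereal_inf_attained; first by exists bopt; rewrite // belief_objectiveE WboptE.
  by move=> _ [b _ <-]; rewrite belief_objectiveE lee_fin.
have primalE : primal_value =
    (beta * entropy_X0Y0 G + \sum_y y0_prob G y * V (init_belief G y))%:E.
  apply: ereal_inf_attained.
    exists (induced_policy G bopt); first exact: induced_policy_is_policy.
    by rewrite objectiveE; under eq_bigr do rewrite WboptE.
  move=> _ [mu mu_policy <-]; rewrite lee_fin.
  exact: (objective_ge gamma_gt0 gamma_lt1 beta_ge0 mu_policy VB Vle).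
have y0_ge0 := pmf_ge0 (y0_prob_pmf G).
split=> //.
- split.
    under eq_bigr do rewrite belief_valueE.
    by rewrite sum_mule_EFin primalE.
  (* The single policy [bopt] is optimal from every initial belief at once, so the infimum of the
     weighted sum equals the weighted sum of the infima. *)
  rewrite primalE EFinD; congr (_ + _)%E; apply/esym; apply: ereal_inf_attained.
    by exists bopt; rewrite // weighted_objectiveE; under eq_bigr do rewrite WboptE.
  move=> _ [b _ <-]; rewrite weighted_objectiveE lee_fin.
  by apply: ler_sum => y _; rewrite ler_wpM2l.
- move=> b; rewrite primalE objectiveE.
  have [sum_eq eq_sum] := eq_weighted_sum y0_ge0 (fun y => VW b (init_belief G y)).
  split=> [[/addrI/sum_eq Wb] y /Wb e|Wb].
    by rewrite belief_objectiveE belief_valueE e.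
  congr (_ + _)%:E; apply: eq_sum => y /Wb.
  by rewrite belief_objectiveE belief_valueE => -[].
Qed.
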